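(* Let $p\ge3$ be a prime number and $K/k$ a Galois extension with Galois group $G=D_{2p}=\langle\sigma,\tau\mid\sigma^p=1,\tau^2=1,\tau\sigma=\sigma^{p-1}\tau\rangle$, the dihedral group of order $2p$. The images of the Galois correspondences of the $p+2$ Hopf Galois structures of $K/k$ are as follows. (1) For the classical Galois structure (given by $N=\rho(G)$), the image is the set of all intermediate fields of $K/k$, namely $k$, $K$, $K^{\langle\sigma\rangle}$ and $K^{\langle\tau\sigma^c\rangle}$ for $c=0,\dots,p-1$. (2) For the nonclassical structure of type $D_{2p}$ (given by $N=\lambda(G)$), the image is $\{k,K^{\langle\sigma\rangle},K\}$. (3) The $p$ structures of type $C_{2p}$ can be indexed by $c\in\{1,\dots,p\}$ so that the image for the structure with index $c$ is $\{k,K^{\langle\sigma\rangle},K^{\langle\tau\sigma^c\rangle},K\}$. In particular, the images of the Galois correspondences for the different Hopf Galois structures of $K/k$ are pairwise different.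
   Context: A Hopf Galois structure on a finite extension $K/k$ is a finite cocommutative $k$-Hopf algebra $H$ for which $K$ is an $H$-module algebra and $j:K\otimes_kH\to\mathrm{End}_k(K)$, $j(s\otimes h)(t)=s(ht)$, is bijective. The Galois correspondence for the structure sends a sub-Hopf algebra $H'$ of $H$ to the intermediate field $K^{H'}=\{x\in K: h\cdot x=\varepsilon(h)x\ \forall h\in H'\}$, $\varepsilon$ being the counit. For $K/k$ Galois with group $G$, let $\lambda,\rho:G\to\mathrm{Perm}(G)$ be $\lambda(g)(x)=gx$ and $\rho(g)(x)=xg^{-1}$. By Greither–Pareigis, the Hopf Galois structures on $K/k$ correspond bijectively to the regular (simply transitive) subgroups $N$ of $\mathrm{Perm}(G)$ normalized by $\lambda(G)$: to $N$ corresponds $H=K[N]^G$ (with $G$ acting on $K$ naturally and on $N$ by conjugation through $\lambda$), acting on $x\in K$ by $\left(\sum_\pi a_\pi\pi\right)\cdot x=\sum_\pi a_\pi\,\pi^{-1}(1_G)(x)$. The structure is of type $M$ if $N\cong M$. $C_{2p}$ is the cyclic group of order $2p$. Known fact (Byott): for $G=D_{2p}$ there are exactly $p+2$ Hopf Galois structures, of which $p$ are of type $C_{2p}$ and two are of type $D_{2p}$, the latter given by $\rho(G)$ and $\lambda(G)$. *)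

(* Defs.v *)
From HB Require Import structures.
From mathcomp Require Import all_boot all_order all_fingroup all_algebra.
From mathcomp Require Import all_solvable all_field.

Set Implicit Arguments.
Unset Strict Implicit.
Unset Printing Implicit Defensive.

Import GRing.Theory.
Local Open Scope ring_scope.

(** * Tensor products of finite-dimensional vector spaces *)

(* U (x) V is represented by the matrices of coordinates on the basis
   e_i (x) f_j, where e and f are the library's bases of U and V. *)
Notation tensor U V := 'M_(\dim {:U}, \dim {:V}).

Definition tens (k : fieldType) (U V : vectType k) (u : U) (v : V) :
    tensor U V :=
  \matrix_(i, j) (coord (vbasis {:U}) i u * coord (vbasis {:V}) j v).

(* The linear map U (x) V -> W induced by f; it is only used with f bilinear,
   and then it sends tens u v to f u v (lemma tlift_tens). *)
Definition tlift (k : fieldType) (U V : vectType k) (W : lmodType k)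
    (f : U -> V -> W) (t : tensor U V) : W :=
  \sum_i \sum_j t i j *: f (vbasis {:U})`_i (vbasis {:V})`_j.

Definition tmap (k : fieldType) (U U' V V' : vectType k)
    (f : U -> U') (g : V -> V') : tensor U V -> tensor U' V' :=
  tlift (fun u v => tens (f u) (g v)).

Definition tassoc (k : fieldType) (U V W : vectType k) :
    tensor (tensor U V) W -> tensor U (tensor V W) :=
  tlift (fun t w => tlift (fun u v => tens u (tens v w)) t).

Definition tmul (k : fieldType) (A B : falgType k) (s t : tensor A B) :
    tensor A B :=
  tlift (fun a b => tlift (fun c d => tens (a * c) (b * d)) t) s.

Lemma tlift_tens (k : fieldType) (U V : vectType k) (W : lmodType k)
    (f : U -> V -> W) (fl : forall v, linear (f^~ v))
    (fr : forall u, linear (f u)) (u : U) (v : V) :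
  tlift f (tens u v) = f u v.
Proof.
pose Fl v' := GRing.isLinear.Build k U W *:%R (f^~ v') (fl v').
pose fL v' : {linear U -> W} := HB.pack (f^~ v') (Fl v').
pose Fr u' := GRing.isLinear.Build k V W *:%R (f u') (fr u').
pose fR u' : {linear V -> W} := HB.pack (f u') (Fr u').
rewrite {2}(coord_vbasis (memvf u)) {2}(coord_vbasis (memvf v)) /tlift.
rewrite -[RHS]/(fL _ _) linear_sum; apply: eq_bigr => i _.
rewrite linearZ /= -[f _ _]/(fR _ _) linear_sum scaler_sumr.
by apply: eq_bigr => j _; rewrite linearZ scalerA mxE.
Qed.

(** * Hopf algebras *)

Record hopfAlgebra (k : fieldType) := HopfAlgebra {
  hopf_sort :> falgType k;
  comul : {linear hopf_sort -> tensor hopf_sort hopf_sort};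
  counit : {linear hopf_sort -> k^o};
  antipode : {linear hopf_sort -> hopf_sort};
  comulA : forall h : hopf_sort,
    tassoc (tmap comul id (comul h)) = tmap id comul (comul h);
  counit_comull : forall h : hopf_sort,
    tlift (fun a b => (counit a : k) *: b) (comul h) = h;
  counit_comulr : forall h : hopf_sort,
    tlift (fun a b => (counit b : k) *: a) (comul h) = h;
  comul1 : comul 1 = tens 1 1;
  comulM : forall a b : hopf_sort,
    comul (a * b) = tmul (comul a) (comul b);
  counit1 : counit 1 = 1 :> k;
  counitM : forall a b : hopf_sort, counit (a * b) = counit a * counit b :> k;
  antipodel : forall h : hopf_sort,
    tlift (fun a b => antipode a * b) (comul h) = (counit h : k)%:A;
  antipoder : forall h : hopf_sort,
    tlift (fun a b => a * antipode b) (comul h) = (counit h : k)%:A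
}.

Arguments comul {k _}.
Arguments counit {k _}.
Arguments antipode {k _}.

Definition cocommutative (k : fieldType) (H : hopfAlgebra k) : Prop :=
  forall h : H, tlift (fun a b => tens b a) (comul h) = comul h.

Definition sub_hopf (k : fieldType) (H : hopfAlgebra k) (U : {vspace H}) :
    Prop :=
  [/\ 1 \in U,
      forall a b, a \in U -> b \in U -> a * b \in U,
      forall a, a \in U -> antipode a \in U
    & forall a, a \in U -> exists s : seq (H * H),
        all (fun xy => (xy.1 \in U) && (xy.2 \in U)) s
        /\ comul a = \sum_(xy <- s) tens xy.1 xy.2].

(** * Hopf Galois structures *)

Section HopfGalois.

Variables (k : fieldType) (K : fieldExtType k).

(* The map j : K (x) H -> End_k(K), j (s (x) h) (x) = s * (h . x), for an
   action of H on K by k-linear endomorphisms. *)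
Definition hopf_j (H : hopfAlgebra k) (act : H -> 'End(K)) :
    tensor K H -> 'End(K) :=
  tlift (fun (s : K) (h : H) => (amull s \o act h)%VF).

Record hopfGalois := HopfGalois {
  hg_hopf :> hopfAlgebra k;
  hg_cocomm : cocommutative hg_hopf;
  hg_act : {linear hg_hopf -> 'End(K)};
  hg_act1 : forall x : K, hg_act 1 x = x;
  hg_actM : forall (a b : hg_hopf) (x : K),
    hg_act (a * b) x = hg_act a (hg_act b x);
  hg_act_unit : forall h : hg_hopf, hg_act h 1 = (counit h : k)%:A;
  hg_act_mul : forall (h : hg_hopf) (x y : K),
    hg_act h (x * y) =
      tlift (fun a b => hg_act a x * hg_act b y) (comul h);
  hg_j_bij : bijective (hopf_j hg_act)
}.

Arguments hg_act {_}.

Definition hg_iso (H1 H2 : hopfGalois) : Prop :=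
  exists f : {linear H1 -> H2},
    [/\ bijective f, f 1 = 1 & forall a b, f (a * b) = f a * f b] /\
    [/\ forall a, comul (f a) = tmap f f (comul a),
        forall a, counit (f a) = counit a,
        forall a, antipode (f a) = f (antipode a)
      & forall a x, hg_act (f a) x = hg_act a x].

(* E = K^U *)
Definition is_fixed_space (H : hopfGalois) (U : {vspace H}) (E : {vspace K}) :
    Prop :=
  forall x : K, x \in E <->
    (forall h : H, h \in U -> hg_act h x = (counit h : k) *: x).

Definition galois_image (H : hopfGalois) (E : {vspace K}) : Prop :=
  exists U : {vspace H}, sub_hopf U /\ is_fixed_space U E.

End HopfGalois.

Arguments hg_act {k K _}.

(** * The structures attached to regular subgroups *)

Section GreitherPareigis.

Variables (k : fieldType) (K : splittingFieldType k).

(* Since 1 is the base field k, this type is all of Gal(K/k). *)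
Local Notation G := (gal_of {:K}).

(* The composite g o h of automorphisms.  The library's product of
   automorphisms (and of permutations) composes from left to right,
   (h * g) x = g (h x), so the factors are swapped here, and below wherever a
   product of permutations is taken. *)
Definition gal_comp (g h : G) : G := (h * g)%g.

(* lambda(g)(x) = g o x and rho(g)(x) = x o g^-1. *)
Definition gal_lambda (g : G) : {perm G} := perm (mulIg g).
Definition gal_rho (g : G) : {perm G} := perm (mulgI (g^-1)%g).

Lemma gal_lambdaE (g x : G) : gal_lambda g x = gal_comp g x.
Proof. by rewrite permE. Qed.

Lemma gal_rhoE (g x : G) : gal_rho g x = gal_comp x (g^-1)%g.
Proof. by rewrite permE. Qed.

Definition lambda_image : {set {perm G}} := [set gal_lambda g | g : G].
Definition rho_image : {set {perm G}} := [set gal_rho g | g : G].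

Definition regular (N : {set {perm G}}) : Prop :=
  forall x y : G, exists! pi : {perm G}, pi \in N /\ pi x = y.

(* The elements \sum_pi a_pi pi of K[Perm(G)] lying in K[N]^G.  In library
   notation, pi ^ gal_lambda g is
   gal_lambda g o pi o (gal_lambda g)^-1. *)
Definition fixed_group_algebra (N : {set {perm G}})
    (a : {ffun {perm G} -> K}) : Prop :=
  (forall pi, pi \notin N -> a pi = 0) /\
  (forall (g : G) pi, a (pi ^ gal_lambda g)%g = g (a pi)).

(* The Hopf Galois structure H is the one attached to N: phi is an isomorphism
   of H onto the k-Hopf algebra K[N]^G which transports the action
   (\sum_pi a_pi pi) . x = \sum_pi a_pi pi^-1(1)(x).  The comultiplication of
   K[N], with values in K[N] (x)_K K[N], is read off on the coefficients of
   alpha (x) beta. *)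
Definition given_by (H : hopfGalois K) (N : {set {perm G}}) : Prop :=
  exists phi : {linear H -> {ffun {perm G} -> K}},
    [/\ injective phi,
        forall a, fixed_group_algebra N a <-> exists h, phi h = a,
        forall pi, phi 1 pi = (pi == 1%g)%:R
      & forall h h' pi, phi (h * h') pi =
          \sum_alpha \sum_(beta | (beta * alpha)%g == pi)
            phi h alpha * phi h' beta] /\
    [/\ forall h alpha beta,
          tlift (fun a b => phi a alpha * phi b beta) (comul h) =
            if alpha == beta then phi h alpha else 0,
        forall h, (counit h : k)%:A = \sum_pi phi h pi,
        forall h pi, phi (antipode h) pi = phi h (pi^-1)%g
      & forall h x, hg_act h x =
          \sum_pi phi h pi * ((pi^-1)%g (1%g : G) : G) x].

Definition of_type (H : hopfGalois K) (gT : finGroupType) (M : {group gT}) :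
    Prop :=
  exists N : {group {perm G}},
    [/\ regular N, lambda_image \subset 'N(N)%g, given_by H N & N \isog M].

End GreitherPareigis.

(* Main.v *)
Require Import Defs.
From HB Require Import structures.
From mathcomp Require Import all_boot all_order all_fingroup all_algebra.
From mathcomp Require Import all_solvable all_field.

Set Implicit Arguments.
Unset Strict Implicit.
Unset Printing Implicit Defensive.

Import GRing.Theory.

(** Let G be the Galois group and H a Hopf Galois structure.  By Dedekind's
    theorem the automorphisms form a K-basis of End_k(K), so that every h in H
    acts as x |-> \sum_g a_g(h) g(x) for unique k-linear functions
    a_g : H -> K.  Bijectivity of j says that the a_g form a K-basis of
    Hom_k(H, K), and h(xy) = \sum h_1(x) h_2(y) says that they are orthogonal
    idempotents for the convolution product; the dual basis of K (x) H therefore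
    consists of grouplike elements (gcoef_comul).  The Galois group permutes the
    a_g, as it permutes such families of idempotents (gal_gcoef_perm).  Comparing
    the action of a product hh' with the composite of the actions turns this
    permutation action into a second group law on the set G (star), whose
    translations form a regular subgroup N of Perm(G) normalised by lambda(G),
    and H is K[N]^G (hopf_galois_given_by).

    Conversely, Galois descent makes K[N]^G a form of K[N].  Taking traces shows
    that equivariant vectors independent over k are independent over K
    (descent_separating), and sums over orbits show that a linear form on K[P]
    vanishing on K[P]^G is zero, for every set P stable under lambda(G)
    (fixed_group_algebra_indep).  These two facts give the coproduct, the
    bijectivity of j (given_by_exists), and the Galois correspondence
    (galois_imageP): sub-Hopf algebras correspond to the subgroups P of N
    normalised by lambda(G), with fixed field that of the automorphisms
    pi^-1(1), pi in P.  These automorphisms form a subgroup of G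
    (orbit1_group_set).

    It remains to do group theory for G dihedral, with S = <sigma>.  An element
    f of order p of N commutes with lambda(sigma), which normalises <f> and has
    order p, and lambda(tau) fixes or inverts f; hence <f> is rho(S) or
    lambda(S).  An involution of N commutes
    with <f> or inverts it.  So N is rho(G), lambda(G), or the cyclic group
    generated by lambda(sigma) and rho(t), where t = tau sigma^c is a reflection
    (classification).  Every subgroup of rho(G) is normalised by lambda(G).  A
    subgroup of lambda(G) is normalised by lambda(G) only if it is normal, which
    excludes the groups of order 2.  The cyclic group of t has a single element of order 2, rho(t), which
    yields the fixed field of t.  The reflections t whose fixed field occurs
    tell the p + 2 images apart (standard_eq).

    In the library's groups products are composites read from left to right.
    Thus lambda(g) is x |-> x * g, and rho(g) is x |-> g^-1 * x. *)


(** * Tensor products *)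

Section Tensors.

Local Open Scope ring_scope.

Variable k : fieldType.

Lemma tlift_is_linear (U V : vectType k) (W : lmodType k) (f : U -> V -> W) :
  linear (tlift f).
Proof.
move=> a s t; rewrite /tlift scaler_sumr -big_split; apply: eq_bigr => i _.
rewrite scaler_sumr -big_split; apply: eq_bigr => j _ /=.
by rewrite !mxE scalerDl scalerA.
Qed.

HB.instance Definition _ (U V : vectType k) (W : lmodType k) (f : U -> V -> W) :=
  GRing.isLinear.Build k (tensor U V) W *:%R (tlift f) (tlift_is_linear f).

Lemma eq_tlift (U V : vectType k) (W : lmodType k) (f g : U -> V -> W) :
  f =2 g -> tlift f =1 tlift g.
Proof.
by move=> fg t; apply: eq_bigr => i _; apply: eq_bigr => j _; rewrite fg.
Qed.

Lemma linear_tlift (U V : vectType k) (W W' : lmodType k)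
    (g : {linear W -> W'}) (f : U -> V -> W) (t : tensor U V) :
  g (tlift f t) = tlift (fun u v => g (f u v)) t.
Proof.
rewrite /tlift linear_sum; apply: eq_bigr => i _.
by rewrite linear_sum; apply: eq_bigr => j _; rewrite linearZ.
Qed.

Lemma tlift_sum (U V : vectType k) (W : lmodType k) (I : Type) (r : seq I)
    (P : pred I) (f : I -> U -> V -> W) (t : tensor U V) :
  tlift (fun u v => \sum_(i <- r | P i) f i u v) t =
    \sum_(i <- r | P i) tlift (f i) t.
Proof.
rewrite /tlift [RHS]exchange_big; apply: eq_bigr => i _ /=.
rewrite exchange_big; apply: eq_bigr => j _ /=.
by rewrite scaler_sumr.
Qed.

Lemma tlift_mull (A : algType k) (U V : vectType k) (c : A) (f : U -> V -> A)
    (t : tensor U V) :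
  tlift (fun u v => c * f u v) t = c * tlift f t.
Proof.
rewrite /tlift mulr_sumr; apply: eq_bigr => i _; rewrite mulr_sumr.
by apply: eq_bigr => j _; rewrite scalerAr.
Qed.

Lemma tlift_mulr (A : algType k) (U V : vectType k) (c : A) (f : U -> V -> A)
    (t : tensor U V) :
  tlift (fun u v => f u v * c) t = tlift f t * c.
Proof.
rewrite /tlift mulr_suml; apply: eq_bigr => i _; rewrite mulr_suml.
by apply: eq_bigr => j _; rewrite scalerAl.
Qed.

Lemma tens_is_linearl (U V : vectType k) (v : V) : linear (@tens k U V ^~ v).
Proof.
by move=> a u u'; apply/matrixP => i j; rewrite !mxE linearP mulrDl mulrA.
Qed.

Lemma tens_is_linearr (U V : vectType k) (u : U) : linear (@tens k U V u).
Proof.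
move=> a v v'; apply/matrixP => i j.
by rewrite !mxE linearP mulrDr mulrCA.
Qed.

HB.instance Definition _ (U V : vectType k) (u : U) :=
  GRing.isLinear.Build k V (tensor U V) *:%R (@tens k U V u)
    (@tens_is_linearr U V u).

Definition tensl (U V : vectType k) (v : V) (u : U) : tensor U V := tens u v.

HB.instance Definition _ (U V : vectType k) (v : V) :=
  GRing.isLinear.Build k U (tensor U V) *:%R (@tensl U V v)
    (@tens_is_linearl U V v).

Lemma tlift_id (U V : vectType k) (t : tensor U V) : tlift (@tens k U V) t = t.
Proof.
have fr (W : vectType k) := basis_free (vbasisP {:W}).
apply/matrixP => i j; rewrite /tlift summxE (bigD1 i) //=.
rewrite [X in _ + X]big1 => [|i' /negbTE ni]; last first.
  rewrite summxE big1 // => j' _.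
  by rewrite !mxE !coord_free // ni mul0r mulr0.
rewrite addr0 summxE (bigD1 j) //= big1 => [|j' /negbTE nj]; last first.
  by rewrite !mxE !coord_free // nj !mulr0.
by rewrite !mxE !coord_free // !eqxx !mulr1 addr0.
Qed.

Lemma tens_expand (U V : vectType k) (t : tensor U V) :
  t = \sum_(i < \dim {:U}) tens (vbasis {:U})`_i (\sum_j t i j *: (vbasis {:V})`_j).
Proof.
rewrite -[LHS]tlift_id; apply: eq_bigr => i _.
by rewrite linear_sum; apply: eq_bigr => j _; rewrite linearZ.
Qed.

Lemma tens_expandl (U V : vectType k) (t : tensor U V) :
  t = \sum_(j < \dim {:V}) tens (\sum_i t i j *: (vbasis {:U})`_i) (vbasis {:V})`_j.
Proof.
rewrite -[LHS]tlift_id /tlift exchange_big; apply: eq_bigr => j _.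
rewrite -[RHS]/(tensl _ _) linear_sum; apply: eq_bigr => i _.
by rewrite linearZ.
Qed.

Section Pairing.

Variable A : algType k.

(** The value on t of the product of f and g, functions with values in the
    algebra A. *)
Definition tpair (U V : vectType k) (f : U -> A) (g : V -> A) :
  tensor U V -> A := tlift (fun u v => f u * g v).

HB.instance Definition _ (U V : vectType k) (f : U -> A) (g : V -> A) :=
  GRing.Linear.copy (tpair f g) (tlift (fun u v => f u * g v)).

Lemma tpair_tens (U V : vectType k) (f : {linear U -> A}) (g : {linear V -> A})
    u v :
  tpair f g (tens u v) = f u * g v.
Proof.
rewrite /tpair tlift_tens // => [v' a x y | u' a x y].
  by rewrite linearP mulrDl scalerAl.
by rewrite linearP mulrDr scalerAr.
Qed.

Lemma tpair_expand (U V : vectType k) (f : U -> A) (g : {linear V -> A}) t :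
  tpair f g t =
    \sum_(i < \dim {:U}) f (vbasis {:U})`_i * g (\sum_j t i j *: (vbasis {:V})`_j).
Proof.
apply: eq_bigr => i _; rewrite linear_sum mulr_sumr.
by apply: eq_bigr => j _; rewrite linearZ /= scalerAr.
Qed.

(** The A-linear extensions of the functions phi a separate the points of
    A (x) U, not only those of U. *)
Definition scalar_separating (I : Type) (U : vectType k) (phi : I -> U -> A) :=
  forall s : 'I_(\dim {:U}) -> A,
    (forall a, \sum_i s i * phi a (vbasis {:U})`_i = 0) -> forall i, s i = 0.

Definition separating (I : Type) (U : vectType k) (phi : I -> U -> A) :=
  forall u, (forall a, phi a u = 0) -> u = 0.

End Pairing.

Lemma scalar_separating_sub (A : falgType k) (I : Type) (U : vectType k)
    (phi : I -> {linear U -> A}) :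
  scalar_separating (fun a => phi a) -> separating (fun a => phi a).
Proof.
move=> sep u u0; have u0' a :
    \sum_i (coord (vbasis {:U}) i u)%:A * phi a (vbasis {:U})`_i = 0.
  rewrite -[RHS](u0 a) {2}(coord_vbasis (memvf u)) linear_sum.
  by apply: eq_bigr => i _; rewrite linearZ /= mulr_algl.
rewrite (coord_vbasis (memvf u)) big1 // => i _.
have /eqP := sep _ u0' i; rewrite scaler_eq0 oner_eq0 orbF => /eqP->.
by rewrite scale0r.
Qed.

(** On U (x) V: the coordinates of t along the basis of U are scalar
    combinations, and each of them is killed by all the psi b. *)
Lemma tpair_separating (K : comAlgType k)
    (I J : Type) (U V : vectType k)
    (phi : I -> {linear U -> K}) (psi : J -> {linear V -> K}) :
  scalar_separating (fun a => phi a) -> separating (fun b => psi b) ->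
  forall t : tensor U V,
    (forall a b, tpair (phi a) (psi b) t = 0) -> t = 0.
Proof.
move=> sep_phi sep_psi t t0; rewrite [t]tens_expand big1 // => i _.
suff -> : \sum_j t i j *: (vbasis {:V})`_j = 0 by rewrite linear0.
apply: sep_psi => b; move: i; apply: sep_phi => a.
rewrite -[RHS](t0 a b) tpair_expand.
by apply: eq_bigr => i _; rewrite mulrC.
Qed.

End Tensors.

(** * Independence of automorphisms *)

Section GaloisFacts.

Local Open Scope ring_scope.

Variables (k : fieldType) (K : splittingFieldType k).
Local Notation G := (gal_of {:K}).

Lemma gal_mulE (g h : G) (x : K) : (g * h)%g x = h (g x).
Proof. exact: galM (memvf x). Qed.

Lemma gal_inj (g : G) : injective g.
Proof. exact: fmorph_inj. Qed.

(** Dedekind's theorem on the independence of automorphisms. *)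
Lemma gal_indep (c : G -> K) :
  (forall x, \sum_g c g * g x = 0) -> forall g, c g = 0.
Proof.
by move=> c0 g; apply: (@gal_independent k K {:K} predT) => // x _.
Qed.

Lemma gal_trace_indep (s : K) :
  (forall c, \sum_(g : G) g (c * s) = 0) -> s = 0.
Proof.
move=> s0; have /(_ 1%g) : forall g : G, g s = 0.
  apply: gal_indep => x; rewrite -[RHS](s0 x); apply: eq_bigr => g _.
  by rewrite rmorphM mulrC.
by rewrite gal_id.
Qed.

Hypothesis K_galois : galois 1%VS {:K}.

Lemma gal_full : 'Gal({:K} / 1)%g = [set: G].
Proof.
by apply/setP => g; rewrite inE gal_kHom ?sub1v // k1AHom.
Qed.

Lemma card_gal : #|{: G}| = \dim {:K}.
Proof. by rewrite -cardsT -gal_full -galois_dim // dimv1 divn1. Qed.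

Lemma gal_fixed_scalar (x : K) : (forall g : G, g x = x) -> exists c, x = c%:A.
Proof.
move=> fx; apply/vlineP; have /galois_fixedField <- := K_galois.
by apply/fixedFieldP; rewrite ?memvf.
Qed.

End GaloisFacts.

(** * Galois descent *)

Section Translations.

Variables (k : fieldType) (K : splittingFieldType k).
Local Notation G := (gal_of {:K}).
Local Notation lam := (@gal_lambda k K).

Lemma lamE (g x : G) : lam g x = (x * g)%g.
Proof. by rewrite permE. Qed.

Lemma lamM (g h : G) : lam (g * h)%g = (lam g * lam h)%g.
Proof. by apply/permP => x; rewrite permM !lamE mulgA. Qed.

Lemma lam1 : lam 1%g = 1%g.
Proof. by apply/permP => x; rewrite lamE perm1 mulg1. Qed.

Lemma lamV (g : G) : lam g^-1%g = (lam g)^-1%g.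
Proof. by apply: (mulgI (lam g)); rewrite -lamM !mulgV lam1. Qed.

Lemma conj_lamE (pi : {perm G}) (g x : G) :
  (pi ^ lam g)%g x = (pi (x * g^-1) * g)%g.
Proof. by rewrite /conjg -lamV !permM !lamE. Qed.

Lemma mem_lambda g : lam g \in lambda_image K.
Proof. exact: imset_f. Qed.

Lemma stable_conj (P : {set {perm G}}) (g : G) pi :
  lambda_image K \subset 'N(P)%g -> ((pi ^ lam g)%g \in P) = (pi \in P).
Proof. by move=> nP; rewrite memJ_norm // (subsetP nP) ?mem_lambda. Qed.

Lemma lambda_norms (P : {set {perm G}}) :
  (forall g pi, pi \in P -> (pi ^ lam g)%g \in P) ->
  lambda_image K \subset 'N(P)%g.
Proof.
move=> cP; apply/subsetP => _ /imsetP[g _ ->]; rewrite inE.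
by apply/subsetP => _ /imsetP[pi Ppi ->]; apply: cP.
Qed.

End Translations.

Section Descent.

Local Open Scope ring_scope.

Variables (k : fieldType) (K : splittingFieldType k).
Hypothesis K_galois : galois 1%VS {:K}.
Local Notation G := (gal_of {:K}).
Local Notation lam := (@gal_lambda k K).
Local Notation coefs := {ffun {perm G} -> K}.

Definition coef_at (H : vectType k) (phi : {linear H -> coefs}) (pi : {perm G})
  (h : H) : K := phi h pi.

Lemma coef_at_is_linear (H : vectType k) (phi : {linear H -> coefs}) pi :
  linear (coef_at phi pi).
Proof. by move=> a x y; rewrite /coef_at linearP !ffunE. Qed.

HB.instance Definition _ (H : vectType k) (phi : {linear H -> coefs}) pi :=
  GRing.isLinear.Build k H K *:%R (coef_at phi pi) (coef_at_is_linear phi pi).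

Definition equivariant (a : coefs) :=
  forall (g : G) pi, a (pi ^ lam g)%g = g (a pi).

(** Galois descent: vectors of K[N]^G that are independent over k are
    independent over K.  Multiplying a relation by c and summing its conjugates
    gives a relation with coefficients in k, the traces of the c * s i. *)
Lemma descent_separating (H : vectType k) (phi : {linear H -> coefs}) :
  injective phi -> (forall h, equivariant (phi h)) ->
  scalar_separating (coef_at phi).
Proof.
move=> phi_inj phi_eq s s0 i; apply: gal_trace_indep => c.
pose Tr j := \sum_(g : G) g (c * s j).
have /fin_all_exists[d Dd] j : exists d, Tr j = d%:A.
  apply: gal_fixed_scalar => // g; rewrite rmorph_sum /=.
  rewrite [RHS](reindex_inj (mulIg g)) /=.
  by apply: eq_bigr => h _; rewrite gal_mulE.
have fr := basis_free (vbasisP {:H}).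
rewrite -/(Tr i) Dd -(coord_sum_free d i fr).
suff -> : \sum_j d j *: (vbasis {:H})`_j = 0 by rewrite linear0 scale0r.
apply: phi_inj; rewrite linear0; apply/ffunP => pi; rewrite ffunE.
rewrite -[LHS]/(coef_at phi pi _) linear_sum /=.
transitivity (\sum_j \sum_(g : G)
    g (c * (s j * phi (vbasis {:H})`_j (pi ^ lam g^-1)%g))).
  apply: eq_bigr => j _; rewrite linearZ /= -mulr_algl -Dd mulr_suml.
  apply: eq_bigr => g _; rewrite mulrA [in RHS]rmorphM /=.
  congr (_ * _); rewrite -[RHS](phi_eq _ g) -conjgM -lamM.
  by rewrite mulVg lam1 conjg1.
rewrite exchange_big big1 // => g _.
by rewrite -rmorph_sum -mulr_sumr [X in _ * X]s0 mulr0 rmorph0.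
Qed.

(** Galois descent in the other direction: K[P]^G spans K[P] over K, so that
    no nonzero linear form on K[P] vanishes on it. *)
Lemma fixed_group_algebra_indep (P : {set {perm G}}) (c : {perm G} -> K) :
  lambda_image K \subset 'N(P)%g ->
  (forall a, fixed_group_algebra P a -> \sum_pi c pi * a pi = 0) ->
  forall pi, pi \in P -> c pi = 0.
Proof.
move=> nP c0 pi Ppi.
suff /(_ 1%g) : forall g : G, c (pi ^ lam g)%g = 0 by rewrite lam1 conjg1.
apply: gal_indep => x.
(* The sum of the conjugates of x pi. *)
pose a : coefs := [ffun rho => \sum_(g | (pi ^ lam g)%g == rho) g x].
have fixa : fixed_group_algebra P a.
  split=> [rho rhoP | g rho]; rewrite !ffunE.
    rewrite big1 // => g /eqP Drho.
    by move: rhoP; rewrite -Drho stable_conj ?Ppi.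
  rewrite rmorph_sum (reindex_inj (mulIg g)) /=.
  apply: eq_big => [h | h _]; last exact: gal_mulE.
  by rewrite lamM conjgM (inj_eq (conjg_inj _)).
rewrite -[RHS](c0 a fixa).
transitivity (\sum_rho \sum_(g | (pi ^ lam g)%g == rho) c rho * g x).
  rewrite (exchange_big_dep predT) //=; apply: eq_bigr => g _.
  by rewrite (big_pred1 (pi ^ lam g)%g) // => rho; rewrite eq_sym.
by apply: eq_bigr => rho _; rewrite ffunE mulr_sumr.
Qed.

End Descent.

(** * The image of the Galois correspondence *)

Section GaloisImage.

Local Open Scope ring_scope.

Variables (k : fieldType) (K : splittingFieldType k).
Hypothesis K_galois : galois 1%VS {:K}.
Local Notation G := (gal_of {:K}).
Local Notation lam := (@gal_lambda k K).
Local Notation coefs := {ffun {perm G} -> K}.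

Definition inv_at1 (pi : {perm G}) : G := (pi^-1)%g (1%g : G).

(** The automorphisms by which the elements of P act on K. *)
Definition orbit1 (P : {set {perm G}}) : {set G} :=
  [set inv_at1 pi | pi in P].

Variables (H : hopfGalois K) (N : {set {perm G}}) (phi : {linear H -> coefs}).
Hypothesis N_stable : lambda_image K \subset 'N(N)%g.
Hypothesis phi_inj : injective phi.
Hypothesis phi_im : forall a, fixed_group_algebra N a <-> exists h, phi h = a.
Hypothesis phi1 : forall pi, phi 1 pi = (pi == 1%g)%:R.
Hypothesis phiM : forall h h' pi, phi (h * h') pi =
  \sum_alpha \sum_(beta | (beta * alpha)%g == pi) phi h alpha * phi h' beta.
Hypothesis phi_comul : forall h alpha beta,
  tlift (fun a b => phi a alpha * phi b beta) (comul h) =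
    if alpha == beta then phi h alpha else 0.
Hypothesis phi_counit : forall h, (counit h : k)%:A = \sum_pi phi h pi.
Hypothesis phi_antipode : forall h pi, phi (antipode h) pi = phi h (pi^-1)%g.
Hypothesis phi_act : forall h x, hg_act h x =
  \sum_pi phi h pi * inv_at1 pi x.

Lemma phi_fixed h : fixed_group_algebra N (phi h).
Proof. by apply/phi_im; exists h. Qed.

Lemma phi_equivariant h : equivariant (phi h).
Proof. by have [] := phi_fixed h. Qed.

Lemma phi_out h pi : pi \notin N -> phi h pi = 0.
Proof. by have [out _] := phi_fixed h; apply: out. Qed.

Lemma phi_separating : scalar_separating (coef_at phi).
Proof. exact: descent_separating phi_equivariant. Qed.

Lemma comul_coef h alpha beta :
  tpair (coef_at phi alpha) (coef_at phi beta) (comul h) =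
    if alpha == beta then phi h alpha else 0.
Proof. exact: phi_comul. Qed.

(** K (x) U is the group algebra K[P]. *)
Definition spans_over_scalars (U : {vspace H}) (P : {set {perm G}}) :=
  (forall h pi, h \in U -> pi \notin P -> phi h pi = 0) /\
  (forall c : {perm G} -> K,
     (forall h, h \in U -> \sum_pi c pi * phi h pi = 0) ->
     forall pi, pi \in P -> c pi = 0).

Lemma act_sub_counit h x :
  hg_act h x - (counit h : k) *: x =
    \sum_pi ((inv_at1 pi x - x) * phi h pi).
Proof.
rewrite phi_act -[_ *: x]mulr_algl phi_counit mulr_suml -sumrB.
by apply: eq_bigr => pi _; rewrite mulrBl mulrC [x * _]mulrC.
Qed.

Lemma fixed_space_spans (U : {vspace H}) (P : {set {perm G}}) (E : {vspace K}) :
  spans_over_scalars U P -> is_fixed_space U E <-> E = fixedField (orbit1 P).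
Proof.
case=> outU indU; have fixP x : x \in fixedField (orbit1 P) <->
    (forall h : H, h \in U -> hg_act h x = (counit h : k) *: x).
  split=> [/mem_fixedFieldP[_ fx] h Uh | fx].
    apply/eqP; rewrite -subr_eq0 act_sub_counit big1 // => pi _.
    case Ppi: (pi \in P); last by rewrite (outU h) ?Ppi ?mulr0.
    by rewrite fx ?imset_f // subrr mul0r.
  apply/fixedFieldP; rewrite ?memvf // => _ /imsetP[pi Ppi ->].
  apply/eqP; rewrite -subr_eq0; apply/eqP.
  apply: (indU (fun pi => inv_at1 pi x - x)) Ppi => h Uh.
  by rewrite -act_sub_counit fx ?subrr.
split=> [fixE | ->] //.
by apply/vspaceP => x; apply/idP/idP => [/fixE/fixP | /fixP/fixE].
Qed.

(** A sub-Hopf algebra U is, over K, spanned by the group elements on which it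
    has a nonzero coefficient: the corresponding coordinate functions on U are
    orthogonal idempotents for the convolution product, so they are
    independent. *)
Lemma sub_hopf_spans (U : {vspace H}) : sub_hopf U ->
  exists P : {group {perm G}},
    [/\ P \subset N, lambda_image K \subset 'N(P)%g & spans_over_scalars U P].
Proof.
case=> U1 UM _ Ucom; pose P := [set pi | has (fun u => phi u pi != 0) (vbasis U)].
have inP pi h : h \in U -> phi h pi != 0 -> pi \in P.
  move=> Uh; apply: contraR; rewrite inE => /hasPn P0.
  rewrite -[phi h pi]/(coef_at phi pi h) (coord_vbasis Uh) linear_sum big1 //.
  move=> i _; rewrite linearZ /=; apply/eqP; rewrite scaler_eq0; apply/orP; right.
  by have := P0 (vbasis U)`_i; rewrite mem_nth ?size_tuple // negbK; apply.
have exP pi : pi \in P -> exists2 h, h \in U & phi h pi != 0.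
  by rewrite inE => /hasP[h /vbasis_mem Uh nz]; exists h.
have spanP : spans_over_scalars U P.
  split=> [h pi Uh | c c0 pi /exP[h Uh nz]].
    by apply: contraNeq => /(inP _ _ Uh).
  have: \sum_rho c rho *
      tpair (coef_at phi rho) (coef_at phi pi) (comul h) = 0.
    have [s [/allP Us ->]] := Ucom h Uh.
    transitivity (\sum_rho \sum_(xy <- s)
        c rho * (phi xy.1 rho * phi xy.2 pi)).
      apply: eq_bigr => rho _; rewrite linear_sum mulr_sumr.
      by apply: eq_bigr => xy _; rewrite /= tpair_tens.
    rewrite exchange_big big1_seq // => xy /andP[_ /Us/andP[Ux _]].
    under eq_bigr => rho _ do rewrite mulrA.
    by rewrite -mulr_suml c0 ?mul0r.
  rewrite (bigD1 pi) //= big1 ?addr0 => [|rho /negbTE nrho]; last first.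
    by rewrite comul_coef nrho mulr0.
  by rewrite comul_coef eqxx => /eqP; rewrite mulf_eq0 (negbTE nz) orbF => /eqP.
have P_group : group_set P.
  apply/group_setP; split.
    by apply: (inP _ 1) => //; rewrite phi1 eqxx oner_neq0.
  move=> beta alpha Pbeta Palpha; apply/negPn/negP => notP.
  have [h' Uh' /eqP nz] := exP _ Pbeta; case: nz.
  pose c a := phi h' (beta * alpha * a^-1)%g.
  have <- : c alpha = phi h' beta by rewrite /c mulgK.
  apply: (spanP.2 c) => // h Uh; rewrite -[RHS](spanP.1 (h * h') _ _ notP) ?UM //.
  rewrite phiM; apply: eq_bigr => a _.
  rewrite (big_pred1 (beta * alpha * a^-1)%g) => [|b]; first by rewrite mulrC.
  by rewrite /= -(inj_eq (mulIg a^-1%g)) mulgK.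
exists (Group P_group); split=> //=.
  apply/subsetP => pi /exP[h _ nz]; apply: contraR nz => notN.
  by rewrite phi_out.
apply: lambda_norms => g pi /exP[h Uh nz]; apply: (inP _ h) => //.
by rewrite phi_equivariant fmorph_eq0.
Qed.

(** Conversely U = H meets K[P] spans K[P] by descent.  The coproduct of
    h in U lies in U (x) U: in h_1 (x) h_2, written on a basis of either
    factor, the other factor has no coefficient outside P. *)
Lemma spans_sub_hopf (P : {group {perm G}}) :
  P \subset N -> lambda_image K \subset 'N(P)%g ->
  exists2 U : {vspace H}, sub_hopf U & spans_over_scalars U P.
Proof.
move=> sPN nP.
pose U : {vspace H} := (\bigcap_(pi | pi \notin P) lker (linfun (coef_at phi pi)))%VS.
have memU h : reflect (forall pi, pi \notin P -> phi h pi = 0) (h \in U).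
  apply: (iffP idP) => [Uh pi nPpi | h0].
    move: Uh; rewrite memvE => /subv_bigcapP/(_ pi nPpi).
    by rewrite -memvE memv_ker lfunE => /eqP.
  rewrite memvE; apply/subv_bigcapP => pi nPpi.
  by rewrite -memvE memv_ker lfunE /=; apply/eqP/h0.
have spanU : spans_over_scalars U P.
  split=> [h pi /memU h0 /h0 // | c c0].
  apply: fixed_group_algebra_indep => // a [a0 a_eq].
  have [|h Dh] := (phi_im a).1.
    by split=> // pi nNpi; apply: a0; apply: contra nNpi; apply: (subsetP sPN).
  by rewrite -Dh; apply: c0; apply/memU; rewrite Dh.
exists U => //; split.
- by apply/memU => pi; rewrite phi1; case: eqP => // ->; rewrite group1.
- move=> a b /memU a0 /memU b0; apply/memU => pi nPpi; rewrite phiM big1 // => al _.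
  case Pal: (al \in P); last by rewrite big1 // => be _; rewrite a0 ?Pal ?mul0r.
  rewrite big1 // => be /eqP Dpi; rewrite b0 ?mulr0 //.
  by apply: contra nPpi => Pbe; rewrite -Dpi groupM.
- by move=> a /memU a0; apply/memU => pi nPpi; rewrite phi_antipode a0 ?groupV.
move=> h /memU h0; set t := comul h; pose p := projv U.
pose e := vbasis {:H}.
have t0 al be : (al \notin P) || (be \notin P) ->
    tpair (coef_at phi al) (coef_at phi be) t = 0.
  rewrite comul_coef; case: eqP => // <-; rewrite orbb; exact: h0.
have Ur i : \sum_(j < \dim {:H}) t i j *: e`_j \in U.
  apply/memU => be nPbe; move: i; apply: phi_separating => al.
  rewrite -[RHS](t0 al be) ?nPbe ?orbT // tpair_expand.
  by apply: eq_bigr => i _; rewrite mulrC.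
have Ul j : \sum_(i < \dim {:H}) t i j *: e`_i \in U.
  apply/memU => al nPal; move: j; apply: phi_separating => be.
  rewrite -[RHS](t0 al be) ?nPal //.
  rewrite [in RHS](tens_expandl t) linear_sum; apply: eq_bigr => j _.
  by rewrite /= tpair_tens.
have Dt : t = \sum_i \sum_j t i j *: tens (p e`_i) (p e`_j).
  transitivity (\sum_(i < \dim {:H}) tens e`_i (\sum_j t i j *: p e`_j)).
    rewrite [LHS]tens_expand; apply: eq_bigr => i _; congr (tens _ _).
    rewrite -[LHS](projv_id (Ur i)) linear_sum.
    by apply: eq_bigr => j _; rewrite linearZ.
  transitivity (\sum_(j < \dim {:H}) tens (\sum_i t i j *: p e`_i) (p e`_j)).
    transitivity (\sum_(j < \dim {:H}) tens (\sum_i t i j *: e`_i) (p e`_j)).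
      under eq_bigr => i _ do rewrite linear_sum.
      rewrite exchange_big; apply: eq_bigr => j _ /=.
      rewrite -[RHS]/(tensl _ _) linear_sum; apply: eq_bigr => i _.
      by rewrite !linearZ.
    apply: eq_bigr => j _; congr (tens _ _).
    rewrite -[LHS](projv_id (Ul j)) linear_sum.
    by apply: eq_bigr => i _; rewrite linearZ.
  rewrite [RHS]exchange_big; apply: eq_bigr => j _ /=.
  rewrite -[LHS]/(tensl _ _) linear_sum; apply: eq_bigr => i _.
  by rewrite linearZ.
exists [seq (t ij.1 ij.2 *: p e`_(ij.1), p e`_(ij.2))
         | ij <- enum {: 'I_(\dim {:H}) * 'I_(\dim {:H})}]; split.
  by apply/allP => _ /mapP[ij _ ->] /=; rewrite !(rpredZ, memv_proj).
rewrite big_map big_enum [LHS]Dt pair_bigA; apply: eq_bigr => ij _ /=.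
by rewrite -[RHS]/(tensl _ _) linearZ.
Qed.

Lemma phi_galois_image (E : {vspace K}) : galois_image H E <->
  exists P : {group {perm G}},
    [/\ P \subset N, lambda_image K \subset 'N(P)%g & E = fixedField (orbit1 P)].
Proof.
split=> [[U [/sub_hopf_spans[P [sPN nP spanP]] fixE]] | [P [sPN nP DE]]].
  by exists P; split=> //; apply/(fixed_space_spans E spanP).
have [U hopfU spanU] := spans_sub_hopf sPN nP.
by exists U; split=> //; apply/(fixed_space_spans E spanU).
Qed.

End GaloisImage.

(** * Uniqueness of the structure given by a group *)

Section GivenBy.

Local Open Scope ring_scope.

Variables (k : fieldType) (K : splittingFieldType k).
Hypothesis K_galois : galois 1%VS {:K}.
Local Notation G := (gal_of {:K}).
Local Notation coefs := {ffun {perm G} -> K}.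

Lemma galois_imageP (H : hopfGalois K) (N : {set {perm G}}) :
  lambda_image K \subset 'N(N)%g -> given_by H N ->
  forall E : {vspace K}, galois_image H E <->
    exists P : {group {perm G}},
      [/\ P \subset N, lambda_image K \subset 'N(P)%g
        & E = fixedField (orbit1 P)].
Proof.
move=> nN [phi [[phi_inj phi_im phi1 phiM] [phi_com phi_cou phi_ant phi_act]]].
exact: (@phi_galois_image _ _ K_galois H N phi).
Qed.

Lemma tmap_coef (U V : vectType k) (phi : {linear V -> coefs})
    (f : {linear U -> V}) (alpha beta : {perm G}) (t : tensor U U) :
  tpair (coef_at phi alpha) (coef_at phi beta) (tmap f f t) =
    tlift (fun a b => phi (f a) alpha * phi (f b) beta) t.
Proof.
rewrite /tmap -[LHS]/((tpair (coef_at phi alpha) (coef_at phi beta)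
  : {linear _ -> _}) _) linear_tlift.
by apply: eq_tlift => a b; rewrite /= tpair_tens.
Qed.

(** Both structures embed in K[Perm(G)] with image K[N]^G, and the conditions of
    given_by express each structure map by the coefficients. *)
Lemma given_by_unique (N : {set {perm G}}) (H1 H2 : hopfGalois K) :
  given_by H1 N -> given_by H2 N -> hg_iso H1 H2.
Proof.
case=> phi [[phi_inj phi_im phi1 phiM] [phi_com phi_cou phi_ant phi_act]].
case=> psi [[psi_inj psi_im psi1 psiM] [psi_com psi_cou psi_ant psi_act]].
have transfer (U V : vectType k) (al : {linear U -> coefs})
    (be : {linear V -> coefs}) : injective be ->
    (forall u, exists v, be v = al u) ->
    exists f : {linear U -> V}, forall u, be (f u) = al u.
  move=> be_inj im; have be0 : lker (linfun be) == 0%VS.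
    by apply/lker0P => x y; rewrite !lfunE => /be_inj.
  exists ((linfun be)^-1 \o linfun al)%VF => u.
  have [v Dv] := im u; rewrite /= comp_lfunE lfunE /= -Dv.
  by congr (be _); rewrite -[be v](lfunE be) lker0_lfunK.
have [f Df] : exists f : {linear H1 -> H2}, forall u, psi (f u) = phi u.
  by apply: transfer => // u; apply/psi_im/phi_im; exists u.
have [g Dg] : exists g : {linear H2 -> H1}, forall u, phi (g u) = psi u.
  by apply: transfer => // u; apply/phi_im/psi_im; exists u.
have scalarI : injective (in_alg K) by apply: fmorph_inj.
exists f; split; split.
- by exists g => x; [apply: phi_inj | apply: psi_inj]; rewrite ?(Df, Dg) ?Df.
- by apply: psi_inj; apply/ffunP => pi; rewrite Df psi1 phi1.
- move=> a b; apply: psi_inj; apply/ffunP => pi.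
  by rewrite Df psiM phiM; do 2!apply: eq_bigr => ? _; rewrite !Df.
- move=> a; apply/eqP; rewrite -subr_eq0; apply/eqP.
  have sep := phi_separating K_galois psi_inj psi_im.
  apply: (tpair_separating sep (scalar_separating_sub sep)) => al be.
  rewrite linearB /= tmap_coef [X in X - _]psi_com Df -phi_com; apply/eqP.
  by rewrite subr_eq0; apply/eqP/eq_tlift => x y; rewrite !Df.
- move=> a; apply: scalarI; rewrite !in_algE psi_cou phi_cou.
  by apply: eq_bigr => pi _; rewrite Df.
- move=> a; apply: psi_inj; apply/ffunP => pi.
  by rewrite psi_ant !Df phi_ant.
- by move=> a x; rewrite psi_act phi_act; apply: eq_bigr => pi _; rewrite Df.
Qed.

Lemma given_by_iso (N : {set {perm G}}) (H1 H2 : hopfGalois K) :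
  hg_iso H1 H2 -> given_by H2 N -> given_by H1 N.
Proof.
case=> f [[[g fK gK] f1 fM] [f_com f_cou f_ant f_act]].
case=> psi [[psi_inj psi_im psi1 psiM] [psi_com psi_cou psi_ant psi_act]].
exists (psi \o f); split; split=> /=.
- exact: inj_comp psi_inj (can_inj fK).
- move=> a; split=> [/psi_im[h <-] | [h <-]]; first by exists (g h); rewrite /= gK.
  by apply/psi_im; exists (f h).
- by move=> pi; rewrite f1.
- by move=> h h' pi; rewrite fM.
- by move=> h al be; rewrite -psi_com f_com; apply/esym/tmap_coef.
- by move=> h; rewrite -f_cou.
- by move=> h pi; rewrite -f_ant.
- by move=> h x; rewrite -f_act psi_act.
Qed.

End GivenBy.

(** * Coordinates of a Hopf Galois structure *)

Section EndomorphismBasis.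

Local Open Scope ring_scope.

Variables (k : fieldType) (K : splittingFieldType k).
Hypothesis K_galois : galois 1%VS {:K}.
Local Notation G := (gal_of {:K}).

Definition gal_comb (c : {ffun G -> K}) : 'End(K) :=
  \sum_(g : G) (amull (c g) \o (g : 'End(K)))%VF.

Lemma gal_combE c x : gal_comb c x = \sum_g c g * g x.
Proof.
rewrite /gal_comb sum_lfunE; apply: eq_bigr => g _.
by rewrite comp_lfunE lfunE.
Qed.

Lemma gal_comb_is_linear : linear gal_comb.
Proof.
move=> b c d; apply/lfunP => x.
rewrite add_lfunE scale_lfunE !gal_combE scaler_sumr -big_split.
by apply: eq_bigr => g _; rewrite !ffunE mulrDl scalerAl.
Qed.

HB.instance Definition _ :=
  GRing.isLinear.Build k {ffun G -> K} 'End(K) *:%R gal_comb gal_comb_is_linear.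

(** By Dedekind's theorem and a dimension count, the automorphisms form a
    basis of the K-space of k-linear endomorphisms of K. *)
Lemma gal_coordinates : exists a : {linear 'End(K) -> {ffun G -> K}},
  forall (f : 'End(K)) x, f x = \sum_g a f g * g x.
Proof.
pose D := linfun gal_comb.
have D0 : lker D == 0%VS.
  apply/lker0P => c d; rewrite !lfunE => /lfunP cd; apply/ffunP => g.
  apply/eqP; rewrite -subr_eq0; apply/eqP; move: g.
  apply: gal_indep => x; rewrite -[RHS](subrr (gal_comb c x)) {2}cd.
  by rewrite !gal_combE -sumrB; apply: eq_bigr => g _; rewrite mulrBl.
have DT : limg D = fullv.
  apply/eqP; rewrite eqEdim subvf limg_dim_eq ?(eqP D0) ?capv0 // !dimvf.
  have -> : dim 'End(K) = (dim K * dim K)%N by [].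
  have -> : dim {ffun G -> K} = (#|{: G}| * dim K)%N by [].
  by rewrite card_gal // dimvf leqnn.
exists (D^-1)%VF => f x; rewrite -gal_combE -[gal_comb _](lfunE gal_comb) /=.
by rewrite -/D limg_lfunVK // DT memvf.
Qed.

End EndomorphismBasis.

Section HopfMap.

Local Open Scope ring_scope.

Variables (k : fieldType) (K : splittingFieldType k).

Lemma hopf_jE (A : hopfAlgebra k) (act : A -> 'End(K)) (t : tensor K A) x :
  hopf_j act t x = \sum_(j < \dim {:A})
    (\sum_i t i j *: (vbasis {:K})`_i) * act (vbasis {:A})`_j x.
Proof.
rewrite /hopf_j /tlift exchange_big sum_lfunE; apply: eq_bigr => j _.
rewrite sum_lfunE mulr_suml; apply: eq_bigr => i _.
by rewrite scale_lfunE comp_lfunE lfunE /= scalerAl.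
Qed.

End HopfMap.

Section Coordinates.

Local Open Scope ring_scope.

Variables (k : fieldType) (K : splittingFieldType k).
Hypothesis K_galois : galois 1%VS {:K}.
Local Notation G := (gal_of {:K}).
Variables (H : hopfGalois K) (a : {linear H -> {ffun G -> K}}).
Hypothesis a_act : forall h x, hg_act h x = \sum_g a h g * g x.

Local Notation e := (vbasis {:H}).
Local Notation n := (\dim {:H}).

Definition gcoef (g : G) (h : H) : K := a h g.

Lemma gcoef_is_linear g : linear (gcoef g).
Proof. by move=> b x y; rewrite /gcoef linearP !ffunE. Qed.

HB.instance Definition _ g :=
  GRing.isLinear.Build k H K *:%R (gcoef g) (gcoef_is_linear g).

Lemma hopf_j_coef (t : tensor K H) x :
  hopf_j (@hg_act k K H) t x =
    \sum_g (\sum_(j < n) (\sum_i t i j *: (vbasis {:K})`_i) * gcoef g e`_j) * g x.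
Proof.
rewrite hopf_jE; under eq_bigr => j _ do rewrite a_act mulr_sumr.
rewrite exchange_big; apply: eq_bigr => g _ /=; rewrite mulr_suml.
by apply: eq_bigr => j _; rewrite mulrA.
Qed.

Lemma gcoef_separating : scalar_separating gcoef.
Proof.
move=> s s0 j; pose t : tensor K H := \matrix_(i, j) coord (vbasis {:K}) i (s j).
have Ds l : \sum_i t i l *: (vbasis {:K})`_i = s l.
  rewrite [RHS](coord_vbasis (memvf _)).
  by apply: eq_bigr => i _; rewrite mxE.
have t0 : t = 0.
  apply: (bij_inj (@hg_j_bij _ _ H)); apply/lfunP => x.
  rewrite hopf_j_coef [in RHS]/hopf_j linear0 lfunE /= big1 // => g _.
  rewrite [X in X * _](_ : _ = 0) ?mul0r // -[RHS](s0 g).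
  by apply: eq_bigr => l _; rewrite Ds.
by rewrite -Ds big1 // => i _; rewrite t0 mxE scale0r.
Qed.

(** The elements of K (x) H that act on K as the automorphisms. *)
Lemma gcoef_dual : exists R : G -> 'I_n -> K,
  forall g g', \sum_j R g j * gcoef g' e`_j = (g' == g)%:R.
Proof.
suff /fin_all_exists[R DR] g : exists r : 'I_n -> K,
    forall g', \sum_j r j * gcoef g' e`_j = (g' == g)%:R by exists R.
have [jinv _ jK] := @hg_j_bij _ _ H; pose t := jinv (g : 'End(K)).
exists (fun j => \sum_i t i j *: (vbasis {:K})`_i) => g'.
apply/eqP; rewrite -subr_eq0; apply/eqP; move: g'; apply: gal_indep => x.
under eq_bigr => g' _ do rewrite mulrBl.
rewrite sumrB -hopf_j_coef jK (bigD1 g) //= big1 ?eqxx => [|g' /negbTE->].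
  by rewrite mul1r addr0 subrr.
by rewrite mul0r.
Qed.

Section Dual.

Variable R : G -> 'I_n -> K.
Hypothesis DR : forall g g', \sum_j R g j * gcoef g' e`_j = (g' == g)%:R.

Lemma gcoef_indep (c : G -> K) :
  (forall h, \sum_g c g * gcoef g h = 0) -> forall g, c g = 0.
Proof.
move=> c0 g; transitivity (\sum_j R g j * \sum_g' c g' * gcoef g' e`_j).
  under eq_bigr => j _ do rewrite mulr_sumr.
  rewrite exchange_big (bigD1 g) //= [X in _ + X]big1 => [|g' /negbTE ng].
    rewrite addr0; under eq_bigr => j _ do rewrite mulrCA.
    by rewrite -mulr_sumr DR eqxx mulr1.
  under eq_bigr => j _ do rewrite mulrCA.
  by rewrite -mulr_sumr DR ng mulr0.
by rewrite big1 // => j _; rewrite c0 mulr0.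
Qed.

Lemma gcoef_expand (f : {linear H -> K}) h :
  f h = \sum_g (\sum_j R g j * f e`_j) * gcoef g h.
Proof.
have Rl (l j : 'I_n) : \sum_g gcoef g e`_l * R g j = (l == j)%:R.
  apply/eqP; rewrite -subr_eq0; apply/eqP; move: j.
  apply: gcoef_separating => g'; under eq_bigr => j _ do rewrite mulrBl mulr_suml.
  rewrite sumrB exchange_big /=.
  under eq_bigr => g _ do (under eq_bigr => j _ do rewrite -mulrA;
    rewrite -mulr_sumr DR).
  rewrite (bigD1 g') //= big1 ?eqxx => [|g]; last first.
    by rewrite eq_sym => /negbTE->; rewrite mulr0.
  rewrite [X in _ - X](bigD1 l) //= big1 ?eqxx => [|j]; last first.
    by rewrite eq_sym => /negbTE->; rewrite mul0r.
  by rewrite mulr1 mul1r !addr0 subrr.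
rewrite {1}(coord_vbasis (memvf h)) linear_sum /=.
have Dg g : gcoef g h = \sum_(l < n) coord e l h *: gcoef g e`_l.
  by rewrite {1}(coord_vbasis (memvf h)) linear_sum; apply: eq_bigr => l _; rewrite linearZ.
under [RHS]eq_bigr => g _ do rewrite Dg mulr_sumr.
rewrite exchange_big; apply: eq_bigr => l _ /=.
under eq_bigr => g _ do rewrite -scalerAr mulr_suml.
rewrite -scaler_sumr linearZ; congr (_ *: _).
rewrite exchange_big (bigD1 l) //= [X in _ + X]big1 => [|j nj]; last first.
  under eq_bigr => g _ do rewrite mulrC mulrA.
  by rewrite -mulr_suml Rl eq_sym (negbTE nj) mul0r.
under eq_bigr => g _ do rewrite mulrC mulrA.
by rewrite -mulr_suml Rl eqxx mul1r addr0.
Qed.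

End Dual.

Lemma gcoef_comul h g g' :
  tpair (gcoef g) (gcoef g') (comul h) = if g == g' then gcoef g h else 0.
Proof.
apply/eqP; rewrite -subr_eq0; apply/eqP; move: g'.
apply: gal_indep => y; move: g; apply: gal_indep => x.
under eq_bigr => g _ do rewrite mulr_suml.
have act_com : \sum_g \sum_g' tpair (gcoef g) (gcoef g') (comul h) * (g x * g' y)
    = \sum_g gcoef g h * (g x * g y).
  have := hg_act_mul h x y; rewrite a_act.
  under eq_bigr => g _ do rewrite rmorphM.
  rewrite /gcoef => ->.
  transitivity (tlift (fun u v => \sum_g \sum_g'
      (a u g * a v g') * (g x * g' y)) (comul h)).
    rewrite tlift_sum; apply: eq_bigr => g _.
    by rewrite tlift_sum; apply: eq_bigr => g' _; rewrite tlift_mulr.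
  apply: eq_tlift => u v; rewrite !a_act mulr_suml; apply: eq_bigr => g _.
  rewrite mulr_sumr; apply: eq_bigr => g' _.
  by rewrite -!mulrA; congr (_ * _); rewrite mulrCA.
apply/eqP; move/eqP: act_com; rewrite -subr_eq0 -sumrB; congr (_ == 0).
apply: eq_bigr => g _.
transitivity (\sum_g' (tpair (gcoef g) (gcoef g') (comul h) -
     (if g == g' then gcoef g h else 0)) * (g x * g' y)); last first.
  by apply: eq_bigr => g' _; rewrite mulrA mulrAC.
under [RHS]eq_bigr => g' _ do rewrite mulrBl.
rewrite sumrB; congr (_ - _); rewrite (bigD1 g) //= eqxx big1 ?addr0 // => g'.
by rewrite eq_sym => /negbTE->; rewrite mul0r.
Qed.

End Coordinates.

(** * The regular group of a Hopf Galois structure *)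

Section GreitherPareigisConverse.

Local Open Scope ring_scope.

Variables (k : fieldType) (K : splittingFieldType k).
Hypothesis K_galois : galois 1%VS {:K}.
Local Notation G := (gal_of {:K}).
Local Notation lam := (@gal_lambda k K).
Local Notation coefs := {ffun {perm G} -> K}.
Variables (H : hopfGalois K) (a : {linear H -> {ffun G -> K}}).
Hypothesis a_act : forall h x, hg_act h x = \sum_g a h g * g x.

Local Notation e := (vbasis {:H}).
Local Notation n := (\dim {:H}).
Local Notation gcoef := (gcoef a).

Variable R : G -> 'I_n -> K.
Hypothesis DR : forall g g', \sum_j R g j * gcoef g' e`_j = (g' == g)%:R.

Let indep := gcoef_indep DR.
Let expand := gcoef_expand a_act DR.

Definition gal_gcoef (gamma g : G) (h : H) : K := gamma (gcoef g h).

Lemma gal_gcoef_is_linear gamma g : linear (gal_gcoef gamma g).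
Proof. by move=> b x y; rewrite /gal_gcoef !linearP. Qed.

HB.instance Definition _ gamma g :=
  GRing.isLinear.Build k H K *:%R (gal_gcoef gamma g)
    (gal_gcoef_is_linear gamma g).

Lemma gcoef_neq (g g' : G) : (forall h, gcoef g h = gcoef g' h) -> g = g'.
Proof.
move=> gg'; apply/eqP; have := DR g' g; have := DR g' g'.
under eq_bigr => j _ do rewrite -gg'.
by move=> ->; rewrite eqxx; case: eqP => // _ /eqP; rewrite oner_eq0.
Qed.

(** A conjugate of a coordinate function is a coordinate function: the
    conjugates are again orthogonal idempotents for the convolution product, so
    their coefficients c g g' are 0 or 1, with exactly one 1 for each g'. *)
Lemma gal_gcoef_perm (gamma : G) :
  exists m : G -> G, forall g h, gamma (gcoef g h) = gcoef (m g) h.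
Proof.
pose c (g g' : G) := \sum_j R g' j * gal_gcoef gamma g e`_j.
have Dc g h : gamma (gcoef g h) = \sum_g' c g g' * gcoef g' h.
  exact: (expand (gal_gcoef gamma g)).
have idem g g1 g' : c g g' * c g1 g' = if g == g1 then c g g' else 0.
  apply/eqP; rewrite -subr_eq0; apply/eqP; move: g'; apply: indep => h.
  under eq_bigr => g' _ do rewrite mulrBl.
  rewrite sumrB.
  have -> : \sum_g' (if g == g1 then c g g' else 0) * gcoef g' h =
      gamma (tpair (gcoef g) (gcoef g1) (comul h)).
    rewrite (gcoef_comul a_act); case: eqP => _; first by rewrite Dc.
    by rewrite rmorph0 big1 // => g' _; rewrite mul0r.
  have -> : gamma (tpair (gcoef g) (gcoef g1) (comul h)) =
      tlift (fun u v => \sum_g' \sum_g''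
        c g g' * c g1 g'' * (gcoef g' u * gcoef g'' v)) (comul h).
    rewrite -[LHS]/((gamma : 'End(K)) _) linear_tlift; apply: eq_tlift => u v.
    rewrite [LHS]rmorphM /= !Dc mulr_suml; apply: eq_bigr => g' _.
    by rewrite mulr_sumr; apply: eq_bigr => g'' _; rewrite mulrACA.
  rewrite tlift_sum -sumrB big1 // => g' _; rewrite tlift_sum.
  rewrite (bigD1 g') //= big1 ?addr0 => [|g'' /negbTE ng].
    by rewrite tlift_mull [tlift _ _](gcoef_comul a_act) eqxx subrr.
  by rewrite tlift_mull [tlift _ _](gcoef_comul a_act) eq_sym ng mulr0.
have nz g : exists g', c g g' != 0.
  apply/existsP; apply: contraTT (oner_neq0 K) => /existsPn c0; apply/negPn.
  have -> : 1 = \sum_j R g j * gcoef g e`_j by rewrite DR eqxx.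
  rewrite big1 // => j _.
  rewrite (_ : gcoef g _ = 0) ?mulr0 //; apply: (@gal_inj _ _ gamma).
  rewrite Dc rmorph0 big1 // => g' _.
  by have := c0 g'; rewrite negbK => /eqP->; rewrite mul0r.
have [m Dm] := fin_all_exists nz.
have m_inj : injective m.
  move=> g g1 mgg; apply/eqP/negPn/negP => /negbTE ng.
  have := idem g g1 (m g); rewrite ng => /eqP.
  by rewrite mulf_eq0 (negbTE (Dm g)) mgg (negbTE (Dm g1)).
have [m' mK m'K] := injF_bij m_inj.
exists m => g h; rewrite Dc (bigD1 (m g)) //= big1 => [|g' ng].
  have /eqP := idem g g (m g); rewrite eqxx -subr_eq0 -[X in _ - X]mulr1 -mulrBr.
  by rewrite mulf_eq0 (negbTE (Dm g)) subr_eq0 => /eqP->; rewrite mul1r addr0.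
have := idem g (m' g') g'; rewrite -(inj_eq m_inj) m'K eq_sym (negbTE ng) => /eqP.
by have := Dm (m' g'); rewrite m'K mulf_eq0 => /negbTE->; rewrite orbF => /eqP->; rewrite mul0r.
Qed.

Section Brace.

Variable dot : G -> G -> G.
Hypothesis dotE : forall (gamma g : G) h, gamma (gcoef g h) = gcoef (dot gamma g) h.

Lemma dotM (g h x : G) : dot (g * h)%g x = dot h (dot g x).
Proof. by apply: gcoef_neq => u; rewrite -!dotE gal_mulE. Qed.

Lemma dot1 x : dot 1%g x = x.
Proof. by apply: gcoef_neq => u; rewrite -dotE gal_id. Qed.

Lemma dotK g : cancel (dot g) (dot g^-1%g).
Proof. by move=> x; rewrite -dotM mulgV dot1. Qed.

Lemma dotVK g : cancel (dot g^-1%g) (dot g).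
Proof. by move=> x; rewrite -dotM mulVg dot1. Qed.

Lemma gcoef1 g : gcoef g 1 = (g == 1%g)%:R.
Proof.
apply/eqP; rewrite -subr_eq0; apply/eqP; move: g; apply: gal_indep => x.
under eq_bigr => g _ do rewrite mulrBl.
rewrite sumrB -a_act hg_act1 (bigD1 1%g) //= eqxx mul1r big1 => [|g /negbTE->].
  by rewrite gal_id addr0 subrr.
by rewrite mul0r.
Qed.

Lemma dot_id gamma : dot gamma 1%g = 1%g.
Proof.
apply/eqP; have := gcoef1 (dot gamma 1%g); rewrite -dotE gcoef1 eqxx rmorph1.
by case: eqP => // _ /eqP; rewrite oner_eq0.
Qed.

(** The group law whose group algebra over K is K (x) H. *)
Definition star (x c : G) : G := (dot x^-1 c * x)%g.

Lemma gcoefM c h h' : gcoef c (h * h') =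
  \sum_x \sum_(y | star x y == c) gcoef x h * gcoef y h'.
Proof.
transitivity (\sum_x \sum_(y | (y * x == c)%g) gcoef x h * gcoef (dot x y) h').
  apply/eqP; rewrite -subr_eq0; apply/eqP; move: c; apply: gal_indep => z.
  under eq_bigr => c _ do rewrite mulrBl.
  rewrite sumrB -a_act hg_actM a_act; apply/eqP; rewrite subr_eq0; apply/eqP.
  transitivity (\sum_x \sum_y gcoef x h * gcoef (dot x y) h' * (y * x)%g z).
    apply: eq_bigr => x _; rewrite a_act rmorph_sum mulr_sumr.
    by apply: eq_bigr => y _; rewrite rmorphM -mulrA -dotE gal_mulE.
  rewrite [RHS](eq_bigr (fun c => \sum_x \sum_(y | (y * x == c)%g)
      gcoef x h * gcoef (dot x y) h' * (y * x)%g z)); last first.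
    move=> c _; rewrite mulr_suml; apply: eq_bigr => x _; rewrite mulr_suml.
    by apply: eq_bigr => y /eqP ->.
  rewrite [RHS]exchange_big; apply: eq_bigr => x _ /=.
  rewrite (exchange_big_dep predT) //=; apply: eq_bigr => y _.
  by rewrite (big_pred1 (y * x)%g) // => c; rewrite eq_sym.
apply: eq_bigr => x _; rewrite [RHS](reindex_inj (can_inj (dotK x))) /=.
by apply: eq_bigl => y; rewrite /star dotK.
Qed.

Lemma gcoef_indep2 (C : G -> G -> K) :
  (forall h h', \sum_x \sum_y C x y * (gcoef x h * gcoef y h') = 0) ->
  forall x y, C x y = 0.
Proof.
move=> C0 x y; move: x; apply: indep => h; move: y; apply: indep => h'.
rewrite -[RHS](C0 h h') exchange_big; apply: eq_bigr => y _ /=.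
by rewrite mulr_suml; apply: eq_bigr => x _; rewrite mulrA.
Qed.

(** The automorphisms of K act on K (x) H by automorphisms of its group. *)
Lemma dot_star gamma x y : dot gamma (star x y) = star (dot gamma x) (dot gamma y).
Proof.
pose c := star x y; pose d := dot gamma^-1%g.
pose C u v : K := (star (d u) (d v) == c)%:R - (star u v == dot gamma c)%:R.
have /(_ (dot gamma x) (dot gamma y)) : forall u v, C u v = 0.
  apply: gcoef_indep2 => h h'.
  transitivity (gamma (gcoef c (h * h')) - gcoef (dot gamma c) (h * h')); last first.
    by rewrite dotE subrr.
  rewrite !gcoefM rmorph_sum [X in X - _](reindex_inj (can_inj (dotVK gamma))) /=.
  rewrite -sumrB; apply: eq_bigr => u _; rewrite rmorph_sum.
  rewrite [X in X - _]big_mkcond [X in X - _](reindex_inj (can_inj (dotVK gamma))) /=.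
  rewrite [X in _ - X]big_mkcond -sumrB; apply: eq_bigr => v _.
  rewrite /C -/(d u) -/(d v) mulrBl rmorphM /= !dotE !dotVK.
  by congr (_ - _); case: eqP; rewrite ?mul1r ?mul0r.
rewrite /C /d !dotK eqxx => /eqP; rewrite subr_eq0.
by case: (_ =P dot gamma c) => [-> // | _]; rewrite oner_eq0.
Qed.

Lemma starA x c d : star (star x c) d = star x (star c d).
Proof.
rewrite [in RHS]/star dot_star {1}/star {1}/star invMg dotM.
by rewrite /star !mulgA.
Qed.

Lemma star1 x : star x 1%g = x.
Proof. by rewrite /star dot_id mul1g. Qed.

Lemma star1l c : star 1%g c = c.
Proof. by rewrite /star invg1 dot1 mulg1. Qed.

Lemma star_inj c : injective (star^~ c).
Proof.
move=> x y /(congr1 (fun z => star z (dot c c^-1%g))); rewrite /= !starA.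
by have -> : star c (dot c c^-1)%g = 1%g; rewrite ?star1 // /star dotK mulVg.
Qed.

Definition star_perm c : {perm G} := perm (@star_inj c).

Lemma star_permE c x : star_perm c x = star x c.
Proof. by rewrite permE. Qed.

Lemma star_permM c d : (star_perm c * star_perm d = star_perm (star c d))%g.
Proof. by apply/permP => x; rewrite permM !star_permE starA. Qed.

Lemma star_perm1 : star_perm 1%g = 1%g.
Proof. by apply/permP => x; rewrite star_permE star1 perm1. Qed.

Lemma star_perm_at1 c : star_perm c 1%g = c.
Proof. by rewrite star_permE star1l. Qed.

Lemma star_perm_inj : injective star_perm.
Proof. by move=> c d cd; rewrite -[c]star_perm_at1 cd star_perm_at1. Qed.

Lemma star_perm_conj c g : (star_perm c ^ lam g)%g = star_perm (dot g c).
Proof.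
apply/permP => x; rewrite conj_lamE !star_permE /star -mulgA mulgKV invMg invgK.
by rewrite dotM.
Qed.

Lemma star_group_set : group_set [set star_perm c | c : G].
Proof.
apply/group_setP; split; first by rewrite -star_perm1 imset_f.
by move=> _ _ /imsetP[c _ ->] /imsetP[d _ ->]; rewrite star_permM imset_f.
Qed.

Definition star_group := Group star_group_set.
Local Notation N := star_group.

Lemma star_perm_inN c : star_perm c \in N.
Proof. exact: imset_f. Qed.

Lemma star_perm_inv pi : pi \in N -> (pi^-1)%g = star_perm (inv_at1 pi).
Proof.
by rewrite -groupV => /imsetP[c _ Dpi]; rewrite /inv_at1 Dpi star_perm_at1.
Qed.

Lemma inv_at1_star c : inv_at1 (star_perm c)^-1%g = c.
Proof. by rewrite /inv_at1 invgK star_perm_at1. Qed.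

Lemma inv_at1_inj : {in N &, injective (@inv_at1 k K)}.
Proof.
move=> pi rho Npi Nrho pr; apply: invg_inj.
by rewrite !star_perm_inv ?pr.
Qed.

Lemma star_group_stable : lambda_image K \subset 'N(N)%g.
Proof.
apply: lambda_norms => g _ /imsetP[c _ ->].
by rewrite star_perm_conj star_perm_inN.
Qed.

Lemma star_group_regular : regular N.
Proof.
move=> x y; exists (star_perm (dot x (y * x^-1)%g)); split.
  by rewrite star_perm_inN star_permE /star dotK mulgKV.
move=> _ [/imsetP[c _ ->]]; rewrite star_permE /star => <-.
by rewrite mulgK dotVK.
Qed.

Lemma sum_star_group (F : {perm G} -> K) :
  (forall pi, pi \notin N -> F pi = 0) ->
  \sum_pi F pi = \sum_c F (star_perm c)^-1%g.
Proof.
move=> F0; transitivity (\sum_(pi in N) F pi).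
  by rewrite [RHS]big_mkcond; apply: eq_bigr => pi _; case: ifPn => // /F0.
rewrite (reindex_onto (fun c => (star_perm c)^-1%g) (@inv_at1 k K)).
  by apply: eq_bigl => c; rewrite groupV star_perm_inN inv_at1_star eqxx.
by move=> pi Npi; rewrite -star_perm_inv ?invgK.
Qed.

Definition star_phi (h : H) : coefs :=
  [ffun pi => if pi \in N then gcoef (inv_at1 pi) h else 0].

Lemma star_phi_is_linear : linear star_phi.
Proof.
move=> b x y; apply/ffunP => pi; rewrite !ffunE; case: ifP => _.
  by rewrite linearP.
by rewrite scaler0 addr0.
Qed.

HB.instance Definition _ :=
  GRing.isLinear.Build k H coefs *:%R star_phi star_phi_is_linear.

Lemma star_phi_star h c : star_phi h (star_perm c)^-1%g = gcoef c h.
Proof. by rewrite ffunE groupV star_perm_inN inv_at1_star. Qed.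

Lemma star_phi_out h pi : pi \notin N -> star_phi h pi = 0.
Proof. by rewrite ffunE => /negbTE->. Qed.

Lemma star_phi_equivariant h : equivariant (star_phi h).
Proof.
move=> g pi; case Npi: (pi \in N); last first.
  by rewrite !star_phi_out ?rmorph0 ?stable_conj ?star_group_stable ?Npi.
rewrite -[pi]invgK (star_perm_inv Npi) star_phi_star conjVg star_perm_conj.
by rewrite star_phi_star dotE.
Qed.

Lemma star_phi_inj : injective star_phi.
Proof.
move=> h h' hh'; apply/eqP; rewrite -subr_eq0; apply/eqP.
apply: (scalar_separating_sub (gcoef_separating a_act)) => g.
by rewrite linearB /= -!star_phi_star hh' subrr.
Qed.

Lemma star_phi_surj b :
  fixed_group_algebra N b -> exists h, star_phi h = b.
Proof.
case=> b_out b_eq; pose x c := b (star_perm c)^-1%g.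
pose s j := \sum_g x g * R g j.
have Ds g : \sum_j s j * gcoef g e`_j = x g.
  under eq_bigr => j _ do rewrite mulr_suml.
  rewrite exchange_big (bigD1 g) //= [X in _ + X]big1 => [|g' /negbTE ng].
    under eq_bigr => j _ do rewrite -mulrA.
    by rewrite -mulr_sumr DR eqxx mulr1 addr0.
  under eq_bigr => j _ do rewrite -mulrA.
  by rewrite -mulr_sumr DR eq_sym ng mulr0.
have /fin_all_exists[d Dd] j : exists d, s j = d%:A.
  apply: gal_fixed_scalar => // gamma; apply/eqP; rewrite -subr_eq0; apply/eqP.
  move: j; apply: (gcoef_separating a_act) => g.
  under eq_bigr => j _ do rewrite mulrBl.
  rewrite sumrB Ds -{1}(dotVK gamma g).
  under eq_bigr => j _ do rewrite -dotE -rmorphM.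
  rewrite -rmorph_sum Ds /= /x -b_eq conjVg star_perm_conj dotVK.
  exact: subrr.
exists (\sum_j d j *: e`_j); apply/ffunP => pi.
case Npi: (pi \in N); last by rewrite star_phi_out ?b_out ?Npi.
rewrite -[pi]invgK (star_perm_inv Npi) star_phi_star linear_sum -[RHS]Ds.
by apply: eq_bigr => j _; rewrite linearZ Dd mulr_algl.
Qed.

Lemma star_phi1 pi : star_phi 1 pi = (pi == 1%g)%:R.
Proof.
case Npi: (pi \in N); last first.
  rewrite star_phi_out ?Npi //; case: eqP Npi => // ->.
  by rewrite group1.
rewrite -[pi]invgK (star_perm_inv Npi) star_phi_star gcoef1.
by rewrite eq_invg1 -star_perm1 (inj_eq star_perm_inj).
Qed.

Lemma star_phiM h h' pi : star_phi (h * h') pi =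
  \sum_alpha \sum_(beta | (beta * alpha)%g == pi)
    star_phi h alpha * star_phi h' beta.
Proof.
rewrite sum_star_group; last first.
  by move=> al nNal; rewrite big1 // => be _; rewrite star_phi_out ?mul0r.
case Npi: (pi \in N); last first.
  rewrite star_phi_out ?Npi // big1 // => x _; rewrite big1 // => be /eqP Dpi.
  rewrite [star_phi h' _]star_phi_out ?mulr0 //; apply: contraFN Npi => Nbe.
  by rewrite -Dpi groupM // groupV star_perm_inN.
rewrite -[pi]invgK (star_perm_inv Npi) star_phi_star gcoefM.
apply: eq_bigr => x _; rewrite big_mkcond [RHS]big_mkcond /= sum_star_group.
  apply: eq_bigr => y _; rewrite -invMg (inj_eq invg_inj) star_permM.
  by rewrite (inj_eq star_perm_inj) !star_phi_star.
by move=> be nNbe; rewrite [star_phi h' _]star_phi_out ?mulr0 ?if_same.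
Qed.

Lemma star_phi_comul h alpha beta :
  tlift (fun u v => star_phi u alpha * star_phi v beta) (comul h) =
    if alpha == beta then star_phi h alpha else 0.
Proof.
have tlift0 (f : H -> H -> K) :
    (forall u v, f u v = 0) -> tlift f (comul h) = 0.
  move=> f0; rewrite /tlift big1 // => i _; rewrite big1 // => j _.
  by rewrite f0 scaler0.
case Nal: (alpha \in N); last first.
  by rewrite tlift0 ?star_phi_out ?Nal ?if_same // => u v;
    rewrite star_phi_out ?Nal ?mul0r.
case Nbe: (beta \in N); last first.
  rewrite tlift0 => [|u v].
    by case: eqP Nal Nbe => // ->; case: (beta \in N).
  by rewrite [star_phi v _]star_phi_out ?Nbe ?mulr0.
transitivity (tpair (gcoef (inv_at1 alpha)) (gcoef (inv_at1 beta)) (comul h)).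
  by apply: eq_tlift => u v; rewrite !ffunE Nal Nbe.
by rewrite (gcoef_comul a_act) (inj_in_eq inv_at1_inj) // ffunE Nal.
Qed.

Lemma sum_gcoef h : \sum_g gcoef g h = (counit h : k)%:A.
Proof.
by rewrite -hg_act_unit a_act; apply: eq_bigr => g _; rewrite rmorph1 mulr1.
Qed.

(** The antipode inverts the group elements: it is a left inverse of the
    identity for the convolution product. *)
Lemma gcoef_antipode x y h : star x y = 1%g ->
  gcoef x (antipode h) = gcoef y h.
Proof.
move=> xy1; pose s u g := \sum_j R g j * (gcoef u \o antipode) e`_j.
have Ds u v : gcoef u (antipode v) = \sum_g s u g * gcoef g v.
  exact: (expand (gcoef u \o antipode)).
have s_val u v : s u v = (star u v == 1%g)%:R.
  pose c := star u v.
  suff : forall w, \sum_(u' | star u' w == c) s u' w - (c == 1%g)%:R = 0.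
    move/(_ v)/eqP; rewrite subr_eq0 (big_pred1 u) => [/eqP// | u'].
    by rewrite /c (inj_eq (@star_inj v)).
  apply: indep => h'.
  have := congr1 (gcoef c) (antipodel h').
  rewrite linearZ /= gcoef1 -mulr_algl -sum_gcoef mulr_suml linear_tlift.
  under eq_tlift => u' v'.
    rewrite /= gcoefM; over.
  rewrite tlift_sum => /eqP; rewrite -subr_eq0 => /eqP sum0; rewrite -[RHS]sum0.
  under eq_bigr => w _ do rewrite mulrBl mulr_suml [_%:R * _]mulrC.
  rewrite sumrB; congr (_ - _).
  rewrite (exchange_big_dep predT) //=; apply: eq_bigr => u' _.
  rewrite tlift_sum; apply: eq_bigr => w _.
  transitivity (tlift (fun p q => \sum_g s u' g * (gcoef g p * gcoef w q)) (comul h')).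
    rewrite tlift_sum (bigD1 w) //= big1 ?addr0 => [|g /negbTE ng].
      by rewrite tlift_mull [tlift _ _](gcoef_comul a_act) eqxx.
    by rewrite tlift_mull [tlift _ _](gcoef_comul a_act) ng mulr0.
  apply: eq_tlift => p q; rewrite Ds mulr_suml.
  by apply: eq_bigr => g _; rewrite mulrA.
rewrite Ds (bigD1 y) //= s_val xy1 eqxx mul1r big1 ?addr0 // => z nz.
rewrite s_val -xy1 (_ : star x z == _ = false) ?mul0r //.
apply: contraNF nz => /eqP; rewrite /star => /mulIg xz.
by rewrite (can_inj (dotK _) xz).
Qed.

Lemma star_phi_antipode h pi :
  star_phi (antipode h) pi = star_phi h (pi^-1)%g.
Proof.
case Npi: (pi \in N); last by rewrite !star_phi_out ?groupV ?Npi.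
rewrite -{1}[pi]invgK (star_perm_inv Npi) star_phi_star ffunE star_perm_inN.
apply/gcoef_antipode/star_perm_inj.
by rewrite -star_permM -(star_perm_inv Npi) -star_perm_inv ?groupV // mulgV star_perm1.
Qed.

Lemma star_phi_act h x : hg_act h x = \sum_pi star_phi h pi * inv_at1 pi x.
Proof.
rewrite sum_star_group => [|pi nNpi]; last by rewrite star_phi_out ?mul0r.
by rewrite a_act; apply: eq_bigr => c _; rewrite star_phi_star inv_at1_star.
Qed.

Lemma star_phi_counit h : (counit h : k)%:A = \sum_pi star_phi h pi.
Proof.
rewrite sum_star_group => [|pi nNpi]; last by rewrite star_phi_out.
by rewrite -sum_gcoef; apply: eq_bigr => c _; rewrite star_phi_star.
Qed.

Lemma star_given_by : given_by H N.
Proof.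
exists star_phi; split; split.
- exact: star_phi_inj.
- move=> b; split=> [/star_phi_surj // | [h <-]].
  by split; [apply: star_phi_out | apply: star_phi_equivariant].
- exact: star_phi1.
- exact: star_phiM.
- exact: star_phi_comul.
- exact: star_phi_counit.
- exact: star_phi_antipode.
- exact: star_phi_act.
Qed.

End Brace.

End GreitherPareigisConverse.

Lemma hopf_galois_given_by (k : fieldType) (K : splittingFieldType k)
    (H : hopfGalois K) : galois 1%VS {:K} ->
  exists N : {group {perm gal_of {:K}}},
    [/\ regular N, lambda_image K \subset 'N(N)%g & given_by H N].
Proof.
move=> K_galois; have [c Dc] := gal_coordinates K_galois.
pose a : {linear H -> {ffun gal_of {:K} -> K}} := c \o @hg_act _ _ H.
have a_act h x : (hg_act h x = \sum_g a h g * g x)%R by exact: Dc.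
have [R DR] := gcoef_dual a_act.
have /fin_all_exists[dot dotE] := gal_gcoef_perm a_act DR.
exists (star_group a_act DR dotE); split.
- exact: star_group_regular.
- exact: star_group_stable.
- exact: star_given_by.
Qed.

(** * The Hopf Galois structure of a regular group *)

Section Construction.

Local Open Scope ring_scope.

Variables (k : fieldType) (K : splittingFieldType k).
Hypothesis K_galois : galois 1%VS {:K}.
Local Notation G := (gal_of {:K}).
Local Notation lam := (@gal_lambda k K).
Local Notation coefs := {ffun {perm G} -> K}.
Variable N : {group {perm G}}.
Hypothesis N_stable : lambda_image K \subset 'N(N)%g.
Hypothesis N_regular : regular N.

Variables (A : falgType k) (phi : {linear A -> coefs}).
Hypothesis phi_inj : injective phi.
Hypothesis phi_im : forall a, fixed_group_algebra N a <-> exists h, phi h = a.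
Hypothesis phi1 : forall pi, phi 1 pi = (pi == 1%g)%:R.
Hypothesis phiM : forall h h' pi,
  phi (h * h') pi = \sum_alpha phi h alpha * phi h' (pi * alpha^-1)%g.

Local Notation e := (vbasis {:A}).
Local Notation n := (\dim {:A}).
Local Notation coef := (coef_at phi).

Lemma A_fixed h : fixed_group_algebra N (phi h).
Proof. by apply/phi_im; exists h. Qed.

Lemma A_equivariant h : equivariant (phi h).
Proof. by have [] := A_fixed h. Qed.

Lemma A_out h pi : pi \notin N -> phi h pi = 0.
Proof. by have [out _] := A_fixed h; apply: out. Qed.

Lemma A_separating : scalar_separating coef.
Proof. exact: descent_separating A_equivariant. Qed.

Lemma A_eq h h' : (forall pi, phi h pi = phi h' pi) -> h = h'.
Proof. by move=> hh'; apply/phi_inj/ffunP. Qed.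

Lemma AA_separating (t t' : tensor A A) :
  (forall al be, tpair (coef al) (coef be) t = tpair (coef al) (coef be) t') ->
  t = t'.
Proof.
move=> tt'; apply/eqP; rewrite -subr_eq0; apply/eqP.
apply: (tpair_separating A_separating (scalar_separating_sub A_separating)).
by move=> al be; rewrite linearB /= tt' subrr.
Qed.

(** K (x) A is the whole of K[N]: no nonzero linear form on K[N]
    vanishes on A. *)
Lemma A_spanning (x : {perm G} -> K) : (forall pi, pi \notin N -> x pi = 0) ->
  exists s : 'I_n -> K, forall pi, \sum_j s j * phi e`_j pi = x pi.
Proof.
move=> x0; pose M : 'M[K]_(n, #|{: {perm G}}|) :=
  \matrix_(j, i) phi e`_j (enum_val i).
pose X : 'rV[K]_(#|{: {perm G}}|) := \row_i x (enum_val i).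
have /submxP[s Ds] : (X <= M)%MS.
  rewrite submxE; apply/eqP/matrixP => i l; rewrite !mxE.
  pose c pi := cokermx M (enum_rank pi) l.
  have cN pi : pi \in N -> c pi = 0.
    apply: fixed_group_algebra_indep => // a /phi_im[h <-] {i}.
    rewrite -[LHS]/(\sum_pi c pi * coef pi h).
    rewrite (coord_vbasis (memvf h)).
    under eq_bigr => rho _ do rewrite linear_sum mulr_sumr.
    rewrite exchange_big big1 // => j _ /=.
    under eq_bigr => rho _ do rewrite linearZ /= -scalerAr.
    rewrite -scaler_sumr (_ : \sum_pi _ = 0) ?scaler0 //.
    have /matrixP/(_ j l) := mulmx_coker M; rewrite !mxE => M0.
    rewrite -[RHS]M0 (reindex_onto enum_val enum_rank) => [|rho _]; last first.
      exact: enum_rankK.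
    apply: eq_big => [i0 | i0 _]; first by rewrite enum_valK eqxx.
    by rewrite mxE /c enum_valK mulrC.
  rewrite big1 // => i' _; rewrite mxE.
  case Ni: (enum_val i' \in N); last by rewrite x0 ?mul0r ?Ni.
  by have := cN _ Ni; rewrite /c enum_valK => ->; rewrite mulr0.
exists (s 0) => pi; have /matrixP/(_ 0 (enum_rank pi)) := Ds.
rewrite !mxE enum_rankK => ->; apply: eq_bigr => j _.
by rewrite !mxE enum_rankK.
Qed.

(** * The coalgebra structure *)

Definition tensor_coefs (t : tensor A A) : {ffun {perm G} * {perm G} -> K} :=
  [ffun ab => tpair (coef ab.1) (coef ab.2) t].

Lemma tensor_coefs_is_linear : linear tensor_coefs.
Proof. by move=> b x y; apply/ffunP => ab; rewrite !ffunE linearP. Qed.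

HB.instance Definition _ := GRing.isLinear.Build k (tensor A A)
  {ffun {perm G} * {perm G} -> K} *:%R tensor_coefs tensor_coefs_is_linear.

Definition diagonal (h : A) : {ffun {perm G} * {perm G} -> K} :=
  [ffun ab => if ab.1 == ab.2 then phi h ab.1 else 0].

Lemma diagonal_is_linear : linear diagonal.
Proof.
move=> b x y; apply/ffunP => ab; rewrite !ffunE linearP !ffunE.
by case: ifP; rewrite // scaler0 addr0.
Qed.

HB.instance Definition _ := GRing.isLinear.Build k A
  {ffun {perm G} * {perm G} -> K} *:%R diagonal diagonal_is_linear.

(** The coproduct of K[N] maps A to A (x) A: for each alpha, the row
    beta |-> diagonal h (alpha, beta) is a combination of the rows of the e`_j,
    and uniqueness makes its coefficients equivariant in alpha. *)
Lemma diagonal_descends h : exists t, tensor_coefs t = diagonal h.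
Proof.
have row al : exists s : 'I_n -> K,
    forall be, \sum_j s j * phi e`_j be = if al == be then phi h al else 0.
  apply: A_spanning => be nNbe; case: eqP => // Dal.
  by rewrite A_out // Dal.
have [s Ds] := fin_all_exists row.
have s_eq al j g : s (al ^ lam g)%g j = g (s al j).
  apply/eqP; rewrite -subr_eq0; apply/eqP; move: j; apply: A_separating => be.
  under eq_bigr => j _ do rewrite mulrBl.
  rewrite sumrB [X in X - _]Ds -{2}[be](conjgKV (lam g)).
  under eq_bigr => j _ do rewrite [coef _ _]A_equivariant -rmorphM.
  rewrite -rmorph_sum Ds -{1}[be](conjgKV (lam g)) (inj_eq (conjg_inj _)).
  by rewrite A_equivariant; case: eqP; rewrite /= ?rmorph0 subrr.
have s_out al j : al \notin N -> s al j = 0.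
  move=> nNal; move: j; apply: A_separating => be.
  by rewrite [LHS]Ds A_out ?if_same.
have /fin_all_exists[w Dw] j : exists w, phi w = [ffun al => s al j].
  apply/phi_im; split=> [al nNal | g al]; rewrite !ffunE; last exact: s_eq.
  exact: s_out.
exists (\sum_j tens (w j) e`_j); apply/ffunP => -[al be]; rewrite !ffunE /=.
rewrite linear_sum -Ds; apply: eq_bigr => j _.
by rewrite /= tpair_tens /= /coef_at Dw ffunE.
Qed.

Definition A_comul : 'Hom(A, tensor A A) :=
  ((linfun tensor_coefs)^-1 \o linfun diagonal)%VF.

Lemma A_comul_coef h al be :
  tpair (coef al) (coef be) (A_comul h) = if al == be then phi h al else 0.
Proof.
have -> : tpair (coef al) (coef be) (A_comul h) =
    tensor_coefs (A_comul h) (al, be) by rewrite ffunE.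
rewrite -[tensor_coefs _](lfunE tensor_coefs) /A_comul comp_lfunE.
rewrite [linfun diagonal h]lfunE /= limg_lfunVK; first by rewrite ffunE.
have [t <-] := diagonal_descends h.
by rewrite -[tensor_coefs t](lfunE tensor_coefs) memv_img ?memvf.
Qed.

Lemma A_sum_scalar h : exists c : k, c%:A = \sum_pi phi h pi.
Proof.
have [|c Dc] := @gal_fixed_scalar _ _ K_galois (\sum_pi phi h pi); last by exists c.
move=> g; rewrite rmorph_sum /= [RHS](reindex_inj (conjg_inj (lam g))).
by apply: eq_bigr => pi _; rewrite A_equivariant.
Qed.

Definition coef_sum (h : A) : K := \sum_pi phi h pi.

Lemma coef_sum_is_linear : linear coef_sum.
Proof.
move=> b x y; rewrite /coef_sum scaler_sumr -big_split.
by apply: eq_bigr => pi _; rewrite linearP !ffunE.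
Qed.

HB.instance Definition _ :=
  GRing.isLinear.Build k A K *:%R coef_sum coef_sum_is_linear.

Definition scalar_emb (c : k^o) : K := (c : k) *: (1 : K).

Lemma scalar_emb_is_linear : linear scalar_emb.
Proof. by move=> b x y; rewrite /scalar_emb scalerDl scalerA. Qed.

HB.instance Definition _ :=
  GRing.isLinear.Build k k^o K *:%R scalar_emb scalar_emb_is_linear.

Definition A_counit : 'Hom(A, k^o) :=
  ((linfun scalar_emb)^-1 \o linfun coef_sum)%VF.

Lemma A_counitE h : (A_counit h : k)%:A = \sum_pi phi h pi.
Proof.
rewrite -[LHS]/(scalar_emb (A_counit h)) -[LHS](lfunE scalar_emb).
rewrite /A_counit comp_lfunE [linfun coef_sum h]lfunE /= limg_lfunVK //.
have [c Dc] := A_sum_scalar h.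
by rewrite /coef_sum -Dc -[_%:A](lfunE scalar_emb) memv_img ?memvf.
Qed.

Definition coef_inv (h : A) : coefs := [ffun pi => phi h (pi^-1)%g].

Lemma coef_inv_is_linear : linear coef_inv.
Proof. by move=> b x y; apply/ffunP => pi; rewrite !ffunE linearP !ffunE. Qed.

HB.instance Definition _ :=
  GRing.isLinear.Build k A coefs *:%R coef_inv coef_inv_is_linear.

Definition A_antipode : 'End(A) := ((linfun phi)^-1 \o linfun coef_inv)%VF.

Lemma A_antipodeE h pi : phi (A_antipode h) pi = phi h (pi^-1)%g.
Proof.
rewrite -[phi _](lfunE phi) /A_antipode comp_lfunE [linfun coef_inv h]lfunE /=.
rewrite limg_lfunVK ?ffunE //.
suff /phi_im[h' <-] : fixed_group_algebra N (coef_inv h).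
  by rewrite -[phi h'](lfunE phi) memv_img ?memvf.
split=> [rho nNrho | g rho]; rewrite !ffunE; first by rewrite A_out ?groupV.
by rewrite -conjVg A_equivariant.
Qed.

Lemma tmap_pair (U V U' V' : vectType k) (f : {linear U' -> K})
    (g : {linear V' -> K}) (u : U -> U') (v : V -> V') t :
  tpair f g (tmap u v t) = tlift (fun x y => f (u x) * g (v y)) t.
Proof.
rewrite /tmap -[LHS]/((tpair f g : {linear _ -> _}) _) linear_tlift.
by apply: eq_tlift => x y; rewrite /= tpair_tens.
Qed.

Lemma tassoc_tens (s : tensor A A) (w : A) :
  tassoc (tens s w) = tlift (fun u v => tens u (tens v w)) s.
Proof.
rewrite /tassoc tlift_tens // => [w' | s'].
  exact: tlift_is_linear.
move=> b x y; rewrite /tlift scaler_sumr -big_split; apply: eq_bigr => i _ /=.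
rewrite scaler_sumr -big_split; apply: eq_bigr => j _ /=.
by rewrite !linearP.
Qed.

Lemma A_comulA h :
  tassoc (tmap A_comul id (A_comul h)) = tmap id A_comul (A_comul h).
Proof.
apply/eqP; rewrite -subr_eq0; apply/eqP.
have sep2 : separating (fun bc : {perm G} * {perm G} =>
    tpair (coef bc.1) (coef bc.2)).
  move=> t t0; apply: AA_separating => al be.
  by rewrite (t0 (al, be)) linear0.
apply: (tpair_separating A_separating sep2) => al [be ga] /=.
rewrite linearB /= tmap_pair.
have -> : tlift (fun x y => coef al x * tpair (coef be) (coef ga) (A_comul y))
    (A_comul h) = if be == ga then if al == be then phi h al else 0 else 0.
  transitivity (tlift (fun x y => if be == ga then coef al x * coef be y else 0)
      (A_comul h)).
    apply: eq_tlift => x y; rewrite A_comul_coef.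
    by case: ifP; rewrite ?mulr0.
  case: ifP => _; first exact: A_comul_coef.
  by rewrite /tlift big1 // => i _; rewrite big1 // => j _; rewrite scaler0.
rewrite [tassoc _]linear_tlift -[X in X - _]/((tpair _ _ : {linear _ -> _}) _).
rewrite linear_tlift /=.
transitivity (tlift (fun x y => if al == be then coef al x * coef ga y else 0)
    (A_comul h) - (if be == ga then if al == be then phi h al else 0 else 0)).
  congr (_ - _); apply: eq_tlift => x y; rewrite [tlift _ (tens _ _)]tassoc_tens.
  rewrite -[LHS]/((tpair _ _ : {linear _ -> _}) _) linear_tlift /=.
  transitivity (tpair (coef al) (coef be) (A_comul x) * coef ga y).
    rewrite -tlift_mulr; apply: eq_tlift => u v.
    by rewrite tpair_tens /= tpair_tens mulrA.
  by rewrite A_comul_coef; case: ifP; rewrite ?mul0r.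
case: (al =P be) => [<- | _]; first by
  rewrite -[tlift _ _]/(tpair (coef al) (coef ga) _) A_comul_coef subrr.
rewrite if_same subr0 /tlift big1 // => i _; rewrite big1 // => j _.
exact: scaler0.
Qed.


Lemma coef_tlift (f : A -> A -> A) t pi :
  phi (tlift f t) pi = tlift (fun x y => phi (f x y) pi) t.
Proof. by rewrite -[LHS]/(coef pi _) linear_tlift. Qed.

Lemma A_counit_comull h :
  tlift (fun x y => (A_counit x : k) *: y) (A_comul h) = h.
Proof.
apply: A_eq => be; rewrite coef_tlift.
transitivity (\sum_al tpair (coef al) (coef be) (A_comul h)).
  rewrite /tpair -tlift_sum; apply: eq_tlift => x y.
  by rewrite linearZ ffunE -mulr_algl A_counitE mulr_suml.
rewrite (bigD1 be) //= A_comul_coef eqxx big1 ?addr0 // => al /negbTE nal.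
by rewrite A_comul_coef nal.
Qed.

Lemma A_cocomm h : tlift (fun x y => tens y x) (A_comul h) = A_comul h.
Proof.
apply: AA_separating => al be.
rewrite -[LHS]/((tpair (coef al) (coef be) : {linear _ -> _}) _) linear_tlift.
transitivity (tpair (coef be) (coef al) (A_comul h)).
  by apply: eq_tlift => x y; rewrite /= tpair_tens mulrC.
by rewrite !A_comul_coef eq_sym; case: eqP => // ->.
Qed.

Lemma A_counit_comulr h :
  tlift (fun x y => (A_counit y : k) *: x) (A_comul h) = h.
Proof.
rewrite -{2}[h]A_counit_comull -[in RHS]A_cocomm linear_tlift.
apply: eq_tlift => x y; rewrite [RHS]tlift_tens // => [u | u] b v w.
  by rewrite !linearP /= scalerDl scalerA.
by rewrite scalerDr !scalerA mulrC.
Qed.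

Lemma A_comul1 : A_comul 1 = tens 1 1.
Proof.
apply: AA_separating => al be; rewrite A_comul_coef tpair_tens /= /coef_at !phi1.
rewrite -natrM mulnb; case: (al =P be) => [<- | ab]; first by rewrite andbb.
by case: eqP => //= al1; case: eqP => //= be1; case: ab; rewrite al1.
Qed.

Lemma A_comulM a b : A_comul (a * b) = tmul (A_comul a) (A_comul b).
Proof.
apply: AA_separating => al be; rewrite A_comul_coef.
transitivity (\sum_al' \sum_be' tpair (coef al') (coef be') (A_comul a) *
    tpair (coef (al * al'^-1)%g) (coef (be * be'^-1)%g) (A_comul b)).
  under [RHS]eq_bigr => al' _.
    rewrite (bigD1 al') //= big1 => [|be' ne]; last first.
      by rewrite A_comul_coef eq_sym (negbTE ne) mul0r.
    rewrite !A_comul_coef eqxx addr0 (inj_eq (mulIg _)); over.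
  case: ifP => _; first exact: phiM.
  by rewrite big1 // => al' _; rewrite mulr0.
rewrite /tmul -[RHS]/((tpair (coef al) (coef be) : {linear _ -> _}) _).
rewrite linear_tlift.
transitivity (tlift (fun x y => \sum_al' \sum_be' coef al' x * coef be' y *
    tpair (coef (al * al'^-1)%g) (coef (be * be'^-1)%g) (A_comul b)) (A_comul a)).
  rewrite tlift_sum; apply: eq_bigr => al' _; rewrite tlift_sum.
  by apply: eq_bigr => be' _; rewrite tlift_mulr.
apply: eq_tlift => x y.
rewrite -[RHS]/((tpair (coef al) (coef be) : {linear _ -> _}) _) linear_tlift.
transitivity (tlift (fun u v => \sum_al' \sum_be' coef al' x * coef be' y *
    (coef (al * al'^-1)%g u * coef (be * be'^-1)%g v)) (A_comul b)).
  rewrite tlift_sum; apply: eq_bigr => al' _; rewrite tlift_sum.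
  by apply: eq_bigr => be' _; rewrite tlift_mull.
apply: eq_tlift => u v; rewrite /= tpair_tens /= /coef_at !phiM mulr_suml.
apply: eq_bigr => al' _; rewrite mulr_sumr.
by apply: eq_bigr => be' _; rewrite mulrACA.
Qed.

Lemma scalarI : injective (fun c : k => c%:A : K).
Proof. by move=> c d cd; apply: (fmorph_inj (in_alg K)). Qed.

Lemma A_counit1 : A_counit 1 = 1 :> k.
Proof.
apply: scalarI; rewrite A_counitE (bigD1 1%g) //= phi1 eqxx big1 ?addr0.
  by rewrite scale1r.
by move=> pi /negbTE npi; rewrite phi1 npi.
Qed.

Lemma A_counitM a b : A_counit (a * b) = A_counit a * A_counit b :> k.
Proof.
apply: scalarI; rewrite A_counitE -scalerA -mulr_algl !A_counitE mulr_suml.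
under eq_bigr => pi _ do rewrite phiM.
rewrite exchange_big; apply: eq_bigr => al _ /=.
rewrite -mulr_sumr; congr (_ * _).
by rewrite [RHS](reindex_inj (mulIg al^-1%g)).
Qed.

Lemma A_antipodel h :
  tlift (fun x y => A_antipode x * y) (A_comul h) = (A_counit h : k)%:A.
Proof.
apply: A_eq => pi; rewrite coef_tlift linearZ ffunE phi1 -mulr_algl A_counitE.
transitivity (\sum_al tpair (coef al^-1%g) (coef (pi * al^-1)%g) (A_comul h)).
  rewrite /tpair -tlift_sum; apply: eq_tlift => x y; rewrite phiM.
  by apply: eq_bigr => al _; rewrite A_antipodeE.
rewrite [X in X * _](reindex_inj invg_inj) mulr_suml; apply: eq_bigr => al _.
rewrite A_comul_coef -{1}[al^-1%g]mul1g (inj_eq (mulIg _)) eq_sym.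
by case: eqP; rewrite ?mulr1 ?mulr0.
Qed.

Lemma A_antipoder h :
  tlift (fun x y => x * A_antipode y) (A_comul h) = (A_counit h : k)%:A.
Proof.
apply: A_eq => pi; rewrite coef_tlift linearZ ffunE phi1 -mulr_algl A_counitE.
transitivity (\sum_al tpair (coef al) (coef (al * pi^-1)%g) (A_comul h)).
  rewrite /tpair -tlift_sum; apply: eq_tlift => x y; rewrite phiM.
  by apply: eq_bigr => al _; rewrite A_antipodeE invMg invgK.
rewrite mulr_suml; apply: eq_bigr => al _.
rewrite A_comul_coef -{1}[al]mulg1 (inj_eq (mulgI _)) eq_sym eq_invg1.
by case: eqP; rewrite ?mulr1 ?mulr0.
Qed.

Definition A_hopf : hopfAlgebra k :=
  @HopfAlgebra k A A_comul A_counit A_antipode A_comulA A_counit_comull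
    A_counit_comulr A_comul1 A_comulM A_counit1 A_counitM A_antipodel
    A_antipoder.

(** * The action *)

Lemma A_cocommutative : cocommutative A_hopf.
Proof. exact: A_cocomm. Qed.

Definition A_act (h : A_hopf) : 'End(K) :=
  \sum_pi (amull (phi h pi) \o (inv_at1 pi : 'End(K)))%VF.

Lemma A_actE h x : A_act h x = \sum_pi phi h pi * inv_at1 pi x.
Proof.
rewrite /A_act sum_lfunE; apply: eq_bigr => pi _.
by rewrite comp_lfunE lfunE.
Qed.

Lemma A_act_is_linear : linear A_act.
Proof.
move=> b c d; apply/lfunP => x.
rewrite add_lfunE scale_lfunE !A_actE scaler_sumr -big_split.
by apply: eq_bigr => g _; rewrite linearP !ffunE mulrDl scalerAl.
Qed.

HB.instance Definition _ :=
  GRing.isLinear.Build k A_hopf 'End(K) *:%R A_act A_act_is_linear.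

Lemma A_act1 x : A_act 1 x = x.
Proof.
rewrite A_actE (bigD1 1%g) //= phi1 eqxx mul1r big1 => [|pi /negbTE npi].
  by rewrite /inv_at1 invg1 perm1 gal_id addr0.
by rewrite phi1 npi mul0r.
Qed.

(** The identity behind the multiplicativity of the action: moving the
    automorphism g = alpha^-1(1) across a coefficient of an equivariant element
    conjugates the index of that coefficient by lambda(g). *)
Lemma inv_at1_conj (al be : {perm G}) (g := inv_at1 al) :
  (inv_at1 (be ^ lam g^-1) * g = inv_at1 (be * al))%g.
Proof.
rewrite /inv_at1 -conjVg conj_lamE invgK mul1g mulgKV invMg permM.
by [].
Qed.

Lemma A_actM a b x : A_act (a * b) x = A_act a (A_act b x).
Proof.
rewrite !A_actE; under eq_bigr => pi _ do rewrite phiM mulr_suml.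
rewrite exchange_big; apply: eq_bigr => al _ /=.
rewrite rmorph_sum mulr_sumr (reindex_inj (mulIg al)) /=.
rewrite [RHS](reindex_inj (conjg_inj (lam (inv_at1 al)^-1%g))) /=.
apply: eq_bigr => be _; rewrite mulgK rmorphM /= -gal_mulE inv_at1_conj.
by rewrite A_equivariant -gal_mulE mulVg gal_id mulrA.
Qed.

Lemma A_act_unit h : A_act h 1 = (counit h : k)%:A.
Proof.
by rewrite A_actE A_counitE; apply: eq_bigr => pi _; rewrite rmorph1 mulr1.
Qed.

Lemma A_act_mul h x y :
  A_act h (x * y) = tlift (fun a b => A_act a x * A_act b y) (comul h).
Proof.
rewrite A_actE; transitivity (tlift (fun a b => \sum_al \sum_be
    coef al a * coef be b * (inv_at1 al x * inv_at1 be y)) (A_comul h)).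
  rewrite tlift_sum; apply: eq_bigr => al _; rewrite tlift_sum.
  under eq_bigr => be _ do rewrite tlift_mulr
    -[tlift _ _]/(tpair (coef al) (coef be) _) A_comul_coef.
  rewrite (bigD1 al) //= eqxx big1 => [|be]; first by rewrite addr0 rmorphM.
  by rewrite eq_sym => /negbTE->; rewrite mul0r.
apply: eq_tlift => a b; rewrite !A_actE mulr_suml; apply: eq_bigr => al _.
by rewrite mulr_sumr; apply: eq_bigr => be _; rewrite mulrACA.
Qed.

Lemma regular_section : exists P : G -> {perm G},
  [/\ forall g, P g \in N, forall g, inv_at1 (P g) = g
    & forall pi, pi \in N -> P (inv_at1 pi) = pi].
Proof.
have exP g : exists pi, pi \in N /\ inv_at1 pi = g.
  have [pi [[Npi pig] _]] := N_regular g 1%g.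
  by exists pi; split=> //; rewrite /inv_at1 -pig permK.
have [P DP] := fin_all_exists exP.
exists P; split=> [g | g | pi Npi]; try by case: (DP g).
have [NP P1] := DP (inv_at1 pi).
have [rho [_ uniq]] := N_regular (inv_at1 pi) 1%g.
have inv1 (al : {perm G}) : al (inv_at1 al) = 1%g by rewrite permKV.
transitivity rho; last exact: uniq.
by apply/esym/uniq; split=> //; rewrite -{2}[inv_at1 pi]P1.
Qed.

(** Under K (x) A = K[N] and the bijection pi |-> pi^-1(1) from N to G, the map
    j sends the basis N of K[N] to the basis G of End_k(K). *)
Lemma A_hopf_j_bij : bijective (hopf_j A_act).
Proof.
have [P [NP PK KP]] := regular_section.
pose r (t : tensor K A_hopf) (j : 'I_n) := \sum_i t i j *: (vbasis {:K})`_i.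
have jE t x : hopf_j A_act t x =
    \sum_g (\sum_j r t j * phi e`_j (P g)) * g x.
  rewrite hopf_jE; under eq_bigr => j _ do rewrite A_actE mulr_sumr.
  rewrite exchange_big /=; transitivity (\sum_(pi in N)
      (\sum_j r t j * phi e`_j pi) * inv_at1 pi x).
    rewrite [RHS]big_mkcond; apply: eq_bigr => pi _; case: ifPn => Npi.
      by rewrite mulr_suml; apply: eq_bigr => j _; rewrite mulrA.
    by rewrite big1 // => j _; rewrite A_out ?mul0r ?mulr0.
  rewrite (reindex_onto P (@inv_at1 k K)) => [|pi Npi]; last exact: KP.
  apply: eq_big => [g | g _]; first by rewrite NP PK eqxx.
  by rewrite PK.
pose J := linfun (hopf_j A_act).
have JE t : J t = hopf_j A_act t by rewrite lfunE.
have J0 : lker J == 0%VS.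
  rewrite -subv0; apply/subvP => t; rewrite memv_ker JE memv0 => /eqP Jt0.
  have r0 j : r t j = 0.
    move: j; apply: A_separating => pi.
    case Npi: (pi \in N); last first.
      by rewrite big1 // => j _; rewrite /coef_at A_out ?mulr0 ?Npi.
    rewrite -(KP _ Npi); move: (inv_at1 pi); apply: gal_indep => x.
    by rewrite -jE Jt0 lfunE.
  apply/eqP/matrixP => i j; rewrite mxE.
  have fr := basis_free (vbasisP {:K}).
  by rewrite -(coord_sum_free (fun i => t i j) i fr) [X in coord _ _ X]r0 linear0.
have JT f : f \in limg J.
  have [c Dc] := gal_coordinates K_galois.
  have [|s Ds] := @A_spanning (fun pi => if pi \in N then c f (inv_at1 pi) else 0).
    by move=> pi /negbTE ->.
  pose t : tensor K A := \matrix_(i, j) coord (vbasis {:K}) i (s j).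
  suff <- : J t = f by rewrite memv_img ?memvf.
  apply/lfunP => x; rewrite JE jE Dc; apply: eq_bigr => g _; congr (_ * _).
  have := Ds (P g); rewrite NP PK => <-; apply: eq_bigr => j _; congr (_ * _).
  rewrite [RHS](coord_vbasis (memvf _)).
  by apply: eq_bigr => i _; rewrite mxE.
exists (J^-1)%VF => [t | f]; rewrite -JE; first by rewrite lker0_lfunK.
by rewrite limg_lfunVK.
Qed.

Definition A_hopf_galois : hopfGalois K :=
  @HopfGalois k K A_hopf A_cocommutative A_act A_act1 A_actM A_act_unit
    A_act_mul A_hopf_j_bij.

Lemma A_given_by : given_by A_hopf_galois N.
Proof.
exists phi; split; split=> //.
- move=> h h' pi; rewrite phiM; apply: eq_bigr => al _.
  by rewrite (big_pred1 (pi * al^-1)%g) // => be; rewrite /= -(inj_eq (mulIg al^-1%g)) mulgK.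
- exact: A_comul_coef.
- exact: A_counitE.
- exact: A_antipodeE.
- exact: A_actE.
Qed.

End Construction.

(** The group algebra K[gT] as a k-algebra, with the group elements multiplied
    in the order of composition of maps: alpha beta stands for beta * alpha. *)
Definition group_algebra (k : fieldType) (K : fieldExtType k)
  (gT : finGroupType) := {ffun gT -> K}.

Section GroupAlgebra.

Local Open Scope ring_scope.

Variables (k : fieldType) (K : fieldExtType k) (gT : finGroupType).

HB.instance Definition _ := Vector.copy (group_algebra K gT) {ffun gT -> K}.

Implicit Types x y z : group_algebra K gT.

Definition galg_one : group_algebra K gT := [ffun g => (g == 1%g)%:R].
Definition galg_mul x y : group_algebra K gT :=
  [ffun g => \sum_h x h * y (g * h^-1)%g].

Lemma galg_mulA : associative galg_mul.
Proof.
move=> x y z; apply/ffunP => g; rewrite !ffunE.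
under eq_bigr => h _ do rewrite ffunE mulr_sumr.
under [RHS]eq_bigr => h _ do rewrite ffunE mulr_suml.
rewrite [RHS]exchange_big; apply: eq_bigr => h _ /=.
rewrite [RHS](reindex_inj (mulIg h)); apply: eq_bigr => h' _ /=.
by rewrite mulgK invMg mulgA mulrA.
Qed.

Lemma galg_mul1l : left_id galg_one galg_mul.
Proof.
move=> x; apply/ffunP => g; rewrite ffunE (bigD1 1%g) //= ffunE eqxx mul1r.
rewrite invg1 mulg1 big1 ?addr0 // => h /negbTE nh.
by rewrite ffunE nh mul0r.
Qed.

Lemma galg_mul1r : right_id galg_one galg_mul.
Proof.
move=> x; apply/ffunP => g; rewrite ffunE (bigD1 g) //= ffunE mulgV eqxx mulr1.
rewrite big1 ?addr0 // => h nh.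
by rewrite ffunE -eq_mulgV1 eq_sym (negbTE nh) mulr0.
Qed.

Lemma galg_mulDl : left_distributive galg_mul +%R.
Proof.
move=> x y z; apply/ffunP => g; rewrite !ffunE -big_split.
by apply: eq_bigr => h _; rewrite ffunE mulrDl.
Qed.

Lemma galg_mulDr : right_distributive galg_mul +%R.
Proof.
move=> x y z; apply/ffunP => g; rewrite !ffunE -big_split.
by apply: eq_bigr => h _; rewrite ffunE mulrDr.
Qed.

Lemma galg_one_neq0 : galg_one != 0.
Proof.
apply/eqP => /ffunP/(_ 1%g); rewrite !ffunE eqxx => /eqP.
by rewrite oner_eq0.
Qed.

HB.instance Definition _ := GRing.Zmodule_isNzRing.Build (group_algebra K gT)
  galg_mulA galg_mul1l galg_mul1r galg_mulDl galg_mulDr galg_one_neq0.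

Lemma galg_scaleAl (c : k) x y : c *: (x * y) = (c *: x) * y.
Proof.
apply/ffunP => g; rewrite !ffunE scaler_sumr.
by apply: eq_bigr => h _; rewrite ffunE scalerAl.
Qed.

HB.instance Definition _ := GRing.Lmodule_isLalgebra.Build k
  (group_algebra K gT) galg_scaleAl.

Lemma galg_scaleAr (c : k) x y : c *: (x * y) = x * (c *: y).
Proof.
apply/ffunP => g; rewrite !ffunE scaler_sumr.
by apply: eq_bigr => h _; rewrite ffunE scalerAr.
Qed.

HB.instance Definition _ := GRing.Lalgebra_isAlgebra.Build k
  (group_algebra K gT) galg_scaleAr.

HB.instance Definition _ := Algebra_isFalgebra.Build k (group_algebra K gT).

Definition galg_coef (g : gT) x : K := x g.

Lemma galg_coef_is_linear g : linear (galg_coef g).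
Proof. by move=> c x y; rewrite /galg_coef !ffunE. Qed.

HB.instance Definition _ g := GRing.isLinear.Build k (group_algebra K gT) K
  *:%R (galg_coef g) (galg_coef_is_linear g).

End GroupAlgebra.

Section FixedPoints.

Local Open Scope ring_scope.

Variables (k : fieldType) (K : splittingFieldType k).
Hypothesis K_galois : galois 1%VS {:K}.
Local Notation G := (gal_of {:K}).
Local Notation lam := (@gal_lambda k K).
Variable N : {group {perm G}}.
Hypothesis N_stable : lambda_image K \subset 'N(N)%g.

Local Notation KPerm := (group_algebra K {perm G}).

Definition galois_defect (g : G) (pi : {perm G}) (a : KPerm) : K :=
  a (pi ^ lam g)%g - g (a pi).

Lemma galois_defect_is_linear g pi : linear (galois_defect g pi).
Proof.
move=> c a b; rewrite /galois_defect !ffunE linearP opprD addrACA.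
by rewrite scalerBr.
Qed.

HB.instance Definition _ g pi := GRing.isLinear.Build k KPerm K
  *:%R (galois_defect g pi) (galois_defect_is_linear g pi).

Definition fixed_points : {vspace KPerm} :=
  ((\bigcap_(pi | pi \notin N) lker (linfun (@galg_coef k K _ pi))) :&:
   \bigcap_(g : G) \bigcap_pi lker (linfun (galois_defect g pi)))%VS.

Lemma mem_fixed_points (a : KPerm) :
  a \in fixed_points <-> fixed_group_algebra N a.
Proof.
rewrite memv_cap !memvE; split=> [/andP[/subv_bigcapP a0 /subv_bigcapP aG] | [a0 aG]].
  split=> [pi nNpi | g pi].
    by apply/eqP; have := a0 pi nNpi; rewrite -memvE memv_ker lfunE.
  have /subv_bigcapP/(_ pi isT) := aG g isT.
  by rewrite -memvE memv_ker lfunE /= subr_eq0 => /eqP.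
apply/andP; split; apply/subv_bigcapP.
  by move=> pi nNpi; rewrite -memvE memv_ker lfunE /=; apply/eqP/a0.
move=> g _; apply/subv_bigcapP => pi _.
rewrite -memvE memv_ker lfunE /= /galois_defect.
by rewrite aG subrr.
Qed.

Lemma fixed_points1 : 1 \in fixed_points.
Proof.
apply/mem_fixed_points; split=> [pi nNpi | g pi]; rewrite !ffunE.
  by case: eqP nNpi => // ->; rewrite group1.
by rewrite rmorph_nat -(inj_eq (conjg_inj (lam g)) pi) conj1g.
Qed.

Lemma fixed_points_aspace : is_aspace fixed_points.
Proof.
rewrite /is_aspace has_algid1 ?fixed_points1 //=.
apply/prodvP => a b /mem_fixed_points[a0 aG] /mem_fixed_points[b0 bG].
apply/mem_fixed_points; split=> [pi nNpi | g pi]; rewrite !ffunE.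
  rewrite big1 // => al _; case Nal: (al \in N); last by rewrite a0 ?mul0r ?Nal.
  by rewrite b0 ?mulr0 // groupMr ?groupV.
rewrite rmorph_sum (reindex_inj (conjg_inj (lam g))).
by apply: eq_bigr => al _; rewrite -conjVg -conjMg aG bG [RHS]rmorphM.
Qed.

Definition fixed_algebra : {aspace KPerm} := ASpace fixed_points_aspace.

Lemma fixed_algebra_val1 : vsval (1 : subvs_of fixed_algebra) = 1 :> KPerm.
Proof.
have fixed1 : 1 \in fixed_algebra := fixed_points1.
by apply/eqP; rewrite [_ == _](algid_eq1 fixed_algebra).
Qed.

(** The Hopf Galois structure K[N]^G. *)
Lemma given_by_exists : regular N -> exists H : hopfGalois K, given_by H N.
Proof.
move=> N_regular.
pose phi : {linear subvs_of fixed_algebra -> {ffun {perm G} -> K}} :=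
  @vsval _ _ fixed_algebra.
have phi_inj : injective phi by apply: val_inj.
have phi_im a : fixed_group_algebra N a <-> exists h, phi h = a.
  split=> [/mem_fixed_points aV | [h <-]]; last exact/mem_fixed_points/subvsP.
  by exists (Subvs aV).
have phi1 pi : phi 1 pi = (pi == 1%g)%:R.
  by rewrite [phi 1]fixed_algebra_val1 ffunE.
have phiM h h' pi :
    phi (h * h') pi = \sum_alpha phi h alpha * phi h' (pi * alpha^-1)%g.
  by rewrite [LHS]ffunE.
exists (A_hopf_galois K_galois N_stable N_regular phi_inj phi_im phi1 phiM).
exact: A_given_by.
Qed.

End FixedPoints.

(** * Dihedral groups *)

Section PrimeOrder.

Local Open Scope group_scope.

Variables (gT : finGroupType) (p : nat) (f x : gT).
Hypotheses (p_prime : prime p) (of_p : #[f] = p) (nf : f ^ x \in <[f]>).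

Lemma conj_power_iter m : f ^ x = f ^+ m -> forall j, f ^ (x ^+ j) = f ^+ (m ^ j).
Proof.
move=> Dm; elim=> [|j IHj]; first by rewrite expg0 conjg1 expg1.
by rewrite expgSr conjgM IHj conjXg Dm -expgM -expnS.
Qed.

(** x conjugates f to a power f^m, and m^p = m modulo p. *)
Lemma conj_fixed_prime_order : x ^+ p = 1 -> f ^ x = f.
Proof.
have [m Dm] := cycleP _ _ nf; move=> xp.
have := conj_power_iter Dm p; rewrite xp conjg1 => {2}->.
by rewrite Dm; apply/eqP; rewrite eq_expg_mod_order of_p fermat_little.
Qed.

Lemma conj_pm_prime_order : f ^ (x * x) = f -> f ^ x = f \/ f ^ x = f^-1.
Proof.
have [m Dm] := cycleP _ _ nf; rewrite conjgM Dm conjXg Dm -expgM => /eqP.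
rewrite -{2}[f]expg1 eq_expg_mod_order of_p => mm1.
have m_gt0 : 0 < m.
  by case: (m) mm1 => //; rewrite mul0n mod0n modn_small ?prime_gt1.
have : p %| (m - 1) * (m + 1).
  by rewrite -subn_sqr exp1n -mulnn -eqn_mod_dvd ?muln_gt0 ?m_gt0.
rewrite Euclid_dvdM // -eqn_mod_dvd // addn1 => /orP[m1 | dv].
  by left; apply/eqP; rewrite -{2}[f]expg1 eq_expg_mod_order of_p.
right; apply/eqP; rewrite eq_sym eq_invg_mul -expgS -order_dvdn of_p.
exact: dv.
Qed.

End PrimeOrder.

Section DihedralGroup.

Local Open Scope group_scope.

Variables (gT : finGroupType) (p : nat) (sigma tau : gT).
Hypotheses (p_prime : prime p) (p_ge3 : 2 < p).
Hypothesis card_dih : #|[set: gT]| = (2 * p)%N.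
Hypothesis gen_dih : [set: gT] = <<[set sigma; tau]>>.
Hypotheses (sigma_p : sigma ^+ p = 1) (tau_2 : tau ^+ 2 = 1).
Hypothesis sigma_tau : sigma ^ tau = sigma^-1.

Local Notation S := <[sigma]>.

Lemma dih_odd : odd p.
Proof. by case: (even_prime p_prime) p_ge3 => [-> |]. Qed.

Lemma dih_product : [set: gT] = S * <[tau]>.
Proof.
rewrite gen_dih -norm_joinEr; last first.
  by rewrite cycle_subG inE -cycleJ sigma_tau cycle_subG groupV cycle_id.
by rewrite joing_idl joing_idr.
Qed.

Lemma dih_order_sigma : #[sigma] = p.
Proof.
have le2 : #[tau] <= 2 by rewrite dvdn_leq // order_dvdn tau_2.
have : #[sigma] %| p by rewrite order_dvdn sigma_p.
case/primeP: p_prime => _ /[apply] /orP[/eqP s1 | /eqP //].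
have := mul_cardG S <[tau]>%G; rewrite -dih_product card_dih.
rewrite -!orderE s1 mul1n => card_tau.
have : 2 * p <= 2 by rewrite (leq_trans _ le2) // card_tau leq_pmulr // cardG_gt0.
by rewrite leqNgt -{1}[2]muln1 ltn_pmul2l // prime_gt1.
Qed.

Lemma dih_card_S : #|S| = p.
Proof. exact: dih_order_sigma. Qed.

Lemma dih_tauNS : tau \notin S.
Proof.
apply/negP => St; have: #|[set: gT]| <= p.
  by rewrite dih_product mulGSid ?cycle_subG // dih_card_S.
by rewrite card_dih mul2n -addnn -{3}[p]addn0 leq_add2l leqNgt prime_gt0.
Qed.

Lemma dih_tauV : tau^-1 = tau.
Proof. by apply/eqP; rewrite eq_invg_mul -expg2 tau_2. Qed.

Lemma dih_cover x : (x \in S) || (x * tau \in S).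
Proof.
have : x \in S * <[tau]> by rewrite -dih_product inE.
case/mulsgP => s _ Ss /cycleP[i ->] ->.
rewrite -(odd_double_half i) expgD -muln2 mulnC expgM tau_2 expg1n mulg1.
by case: (odd i); rewrite ?expg1 ?mulg1 ?Ss // -mulgA -expg2 tau_2 mulg1 Ss orbT.
Qed.

Lemma dih_notS x : x \notin S -> exists2 s, s \in S & x = s * tau.
Proof.
move=> nSx; have := dih_cover x; rewrite (negbTE nSx) /= => Sxt.
by exists (x * tau) => //; rewrite -mulgA -expg2 tau_2 mulg1.
Qed.

Lemma dih_conjS s x : s \in S -> x \notin S -> s ^ x = s^-1.
Proof.
move=> Ss /dih_notS[s' Ss' ->].
have -> : s ^ (s' * tau) = s ^ tau.
  rewrite conjgM; congr (_ ^ _); apply/conjg_fixP/commgP.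
  by case/cycleP: Ss => i ->; case/cycleP: Ss' => j ->; apply/commuteX2.
by case/cycleP: Ss => i ->; rewrite conjXg sigma_tau expgVn.
Qed.

Lemma dih_invol x : x \notin S -> x * x = 1.
Proof.
move=> nSx; have [s Ss Dx] := dih_notS nSx.
rewrite {1}Dx -mulgA; have -> : tau * x = s^-1.
  have := dih_conjS Ss dih_tauNS; rewrite conjgE dih_tauV => <-.
  by rewrite Dx.
by rewrite mulgV.
Qed.

Lemma dih_invN x : x \notin S -> x^-1 = x.
Proof. by move=> nSx; apply/eqP; rewrite eq_invg_mul dih_invol. Qed.

Lemma dih_mulNN x y : x \notin S -> y \notin S -> x * y \in S.
Proof.
move=> nSx nSy; have [s Ss ->] := dih_notS nSx; have [s' Ss' ->] := dih_notS nSy.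
by rewrite -mulgA groupMl // -[X in X * _]dih_tauV -conjgE dih_conjS ?groupV ?dih_tauNS.
Qed.

Lemma dih_commS s s' : s \in S -> s' \in S -> s * s' = s' * s.
Proof. by case/cycleP => i ->; case/cycleP => j ->; apply: commuteX2. Qed.

Lemma dih_flip s x : s \in S -> x \notin S -> s * x = x * s^-1.
Proof. by move=> Ss nSx; rewrite conjgC dih_conjS. Qed.

Lemma dih_order2 x : x \notin S -> #[x] = 2.
Proof.
move=> nSx; apply: nt_prime_order; rewrite ?expg2 ?dih_invol //.
by apply: contraNneq nSx => ->; rewrite group1.
Qed.

Lemma dih_sq1 s : s \in S -> s * s = 1 -> s = 1.
Proof.
move=> Ss ss1; apply/eqP; rewrite -order_eq1 -dvdn1.
have cop : coprime p 2 by rewrite coprimen2 dih_odd.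
rewrite -(eqP cop) dvdn_gcd -dih_card_S order_dvdG //=.
by rewrite order_dvdn expg2 ss1.
Qed.

Lemma dih_reflection x : x \notin S ->
  exists c : 'I_p, x = sigma ^+ c * tau.
Proof.
case/dih_notS => s /cyclePmin[i]; rewrite dih_order_sigma => lti -> ->.
by exists (Ordinal lti).
Qed.

Lemma dih_reflectionS x : x \notin S ->
  exists c : 'I_p, x = sigma ^+ c.+1 * tau.
Proof.
case/dih_reflection => c ->; case: c => [[|i] lti] /=.
  have ltp : p.-1 < p by rewrite prednK ?prime_gt0.
  by exists (Ordinal ltp); rewrite /= prednK ?prime_gt0 // sigma_p.
by exists (Ordinal (ltnW lti)).
Qed.

Lemma dih_reflN c : sigma ^+ c * tau \notin S.
Proof. by rewrite groupMl ?mem_cycle // dih_tauNS. Qed.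

Lemma dih_subgroups (Q : {group gT}) :
  [\/ Q = 1 :> {set gT}, Q = S :> {set gT}, Q = [set: gT] :> {set gT}
    | exists2 x, x \notin S & Q = <[x]> :> {set gT}].
Proof.
have [sQS | /subsetPn[x Qx nSx]] := boolP (Q \subset S).
  have [Q1 | /trivgPn[s Qs s1]] := eqVneq (Q : {set gT}) 1; first by constructor 1.
  constructor 2; apply/eqP; rewrite eqEsubset sQS /= prime_meetG ?dih_card_S //.
  by apply/trivgPn; exists s; rewrite // inE Qs (subsetP sQS).
have [S1 | /(prime_meetG _)] := eqVneq (S :&: Q) 1; last first.
  rewrite dih_card_S => /(_ p_prime) sSQ; constructor 3.
  apply/eqP; rewrite eqEsubset subsetT /=; apply/subsetP => y _.
  have [Sy | nSy] := boolP (y \in S); first exact: (subsetP sSQ).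
  by rewrite -(groupMr y Qx) (subsetP sSQ) ?dih_mulNN.
constructor 4; exists x => //; apply/eqP; rewrite eqEsubset cycle_subG Qx andbT.
apply/subsetP => y Qy; have [Sy | nSy] := boolP (y \in S).
  have : y \in S :&: Q by rewrite inE Sy.
  by rewrite S1 => /set1P->; rewrite group1.
have : x * y \in S :&: Q by rewrite inE dih_mulNN ?groupM.
by rewrite S1 => /set1P/eqP; rewrite -eq_invg_mul dih_invN // => /eqP->; rewrite cycle_id.
Qed.

Lemma dih_cycle_refl x y : x \notin S -> y \in <[x]> -> y \notin S -> y = x.
Proof.
move=> nSx /cycleP[i ->]; rewrite -(odd_double_half i) expgD -muln2 mulnC expgM.
rewrite expg2 dih_invol // expg1n mulg1.
by case: (odd i); rewrite ?expg1 // expg0 group1.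
Qed.

End DihedralGroup.

(** * Stable regular subgroups for a dihedral group *)

Section RegularGroups.

Local Open Scope group_scope.

Variables (k : fieldType) (K : splittingFieldType k).
Local Notation G := (gal_of {:K}).
Local Notation lam := (@gal_lambda k K).
Implicit Types (g h x y : G) (pi : {perm G}).

(** x |-> g * x in the library's notation; rho(G) is the set of these. *)
Definition ltr g : {perm G} := gal_rho g^-1.

Lemma ltrE g x : ltr g x = g * x.
Proof. by rewrite permE invgK. Qed.

Lemma ltrM g h : ltr (g * h) = ltr h * ltr g.
Proof. by apply/permP => x; rewrite permM !ltrE mulgA. Qed.

Lemma ltr1 : ltr 1 = 1.
Proof. by apply/permP => x; rewrite ltrE mul1g perm1. Qed.

Lemma ltrX g n : ltr (g ^+ n) = ltr g ^+ n.
Proof.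
elim: n => [|n IHn]; first exact: ltr1.
by rewrite expgSr ltrM IHn expgS.
Qed.

Lemma lamX g n : lam (g ^+ n) = lam g ^+ n.
Proof.
elim: n => [|n IHn]; first exact: lam1.
by rewrite expgSr lamM IHn expgSr.
Qed.

Lemma ltr_lam g h : commute (ltr g) (lam h).
Proof. by apply/permP => x; rewrite !permM !lamE !ltrE mulgA. Qed.

Lemma ltr_conj g h : ltr g ^ lam h = ltr g.
Proof. exact/conjg_fixP/commgP/ltr_lam. Qed.

Lemma lam_conj g h : lam g ^ lam h = lam (g ^ h).
Proof. by rewrite !conjgE !lamM lamV. Qed.

Lemma ltr_inj : injective ltr.
Proof. by move=> g h /permP/(_ 1); rewrite !ltrE !mulg1. Qed.

Lemma lam_inj : injective lam.
Proof. by move=> g h /permP/(_ 1); rewrite !lamE !mul1g. Qed.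

Lemma mem_rho g : ltr g \in rho_image K.
Proof. exact: imset_f. Qed.

Lemma rhoP pi : reflect (exists g, pi = ltr g) (pi \in rho_image K).
Proof.
apply: (iffP imsetP) => [[g _ ->] | [g ->]]; last by exists g^-1.
by exists g^-1; rewrite /ltr invgK.
Qed.

Lemma lambdaP pi : reflect (exists g, pi = lam g) (pi \in lambda_image K).
Proof. by apply: (iffP imsetP) => [[g _ ->] | [g ->]]; exists g. Qed.

Lemma lambda_group_set : group_set (lambda_image K).
Proof.
apply/group_setP; split; first by rewrite -lam1 mem_lambda.
by move=> _ _ /lambdaP[g ->] /lambdaP[h ->]; rewrite -lamM mem_lambda.
Qed.

Lemma rho_group_set : group_set (rho_image K).
Proof.
apply/group_setP; split; first by rewrite -ltr1 mem_rho.
by move=> _ _ /rhoP[g ->] /rhoP[h ->]; rewrite -ltrM mem_rho.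
Qed.

Definition lambda_group := Group lambda_group_set.
Definition rho_group := Group rho_group_set.

Lemma lambda_stable : lambda_image K \subset 'N(lambda_image K).
Proof. exact: (normG lambda_group). Qed.

Lemma rho_stable : lambda_image K \subset 'N(rho_image K).
Proof. by apply: lambda_norms => g _ /rhoP[h ->]; rewrite ltr_conj mem_rho. Qed.

Lemma lambda_regular : regular (lambda_image K).
Proof.
move=> x y; exists (lam (x^-1 * y)); split.
  by rewrite mem_lambda lamE mulKVg.
by move=> _ [/lambdaP[g ->] <-]; rewrite lamE mulKg.
Qed.

Lemma rho_regular : regular (rho_image K).
Proof.
move=> x y; exists (ltr (y * x^-1)); split.
  by rewrite mem_rho ltrE mulgKV.
by move=> _ [/rhoP[g ->] <-]; rewrite ltrE mulgK.
Qed.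

Lemma regular_eq (N : {set {perm G}}) pi rho x :
  regular N -> pi \in N -> rho \in N -> pi x = rho x -> pi = rho.
Proof.
move=> reg Npi Nrho e; have [th [_ uniq]] := reg x (rho x).
by rewrite -(uniq pi) // -(uniq rho).
Qed.

Lemma regular_ex (N : {set {perm G}}) x y :
  regular N -> exists2 pi, pi \in N & pi x = y.
Proof. by move=> reg; have [pi [[Npi e] _]] := reg x y; exists pi. Qed.

Lemma regular_image (N : {set {perm G}}) :
  regular N -> [set pi 1 | pi : {perm G} in N] = [set: G].
Proof.
move=> reg; apply/setP => g; rewrite inE; apply/imsetP.
by have [pi Npi e] := regular_ex 1 g reg; exists pi.
Qed.

Lemma card_regular (N : {set {perm G}}) : regular N -> #|N| = #|[set: G]|.
Proof.
move=> reg; rewrite -(regular_image reg) card_in_imset // => pi rho Npi Nrho.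
exact: regular_eq.
Qed.

Lemma regular_transitive (N : {set {perm G}}) :
  (forall x y, exists2 pi, pi \in N & pi x = y) -> #|N| <= #|[set: G]| ->
  regular N.
Proof.
move=> tr leN x y; have [pi Npi e] := tr x y; exists pi; split=> // rho [Nrho e'].
have /imset_injP inj : #|[set th x | th : {perm G} in N]| == #|N|.
  rewrite eqn_leq leq_imset_card (leq_trans leN) // subset_leq_card //.
  apply/subsetP => z _; apply/imsetP; have [th Nth] := tr x z.
  by exists th.
by apply: inj => //; rewrite e e'.
Qed.

Lemma regular_sub (N M : {set {perm G}}) :
  regular N -> regular M -> N \subset M -> N = M.
Proof.
by move=> rN rM sNM; apply/eqP; rewrite eqEcard sNM !card_regular ?leqnn.
Qed.

Lemma orbit1_regular (N : {set {perm G}}) :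
  regular N -> orbit1 N = [set: G].
Proof.
move=> reg; apply/setP => g; rewrite inE; apply/imsetP.
by have [pi Npi e] := regular_ex g 1 reg; exists pi; rewrite // /inv_at1 -e permK.
Qed.

(** inv_at1 is multiplicative up to a conjugation by an element of lambda(G)
    (inv_at1_conj), and P is stable under such conjugations. *)
Lemma orbit1_group_set (P : {group {perm G}}) :
  lambda_image K \subset 'N(P) -> group_set (orbit1 P).
Proof.
move=> nP; apply/group_setP; split.
  by apply/imsetP; exists 1; rewrite ?group1 // /inv_at1 invg1 perm1.
move=> _ _ /imsetP[be Pbe ->] /imsetP[al Pal ->]; apply/imsetP.
exists (be ^ lam (inv_at1 al) * al); first by rewrite groupM ?stable_conj.
by rewrite -inv_at1_conj -conjgM -lamM mulgV lam1 conjg1.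
Qed.

Lemma inv_at1_lam g : inv_at1 (lam g) = g^-1.
Proof. by rewrite /inv_at1 -lamV lamE mul1g. Qed.

Lemma inv_at1_ltr g : inv_at1 (ltr g) = g^-1.
Proof.
rewrite /inv_at1 (_ : (ltr g)^-1 = ltr g^-1) ?ltrE ?mulg1 //.
by apply/eqP; rewrite eq_invg_mul -ltrM mulVg ltr1.
Qed.

Lemma orbit1_mem (N P : {set {perm G}}) pi :
  regular N -> P \subset N -> pi \in N -> inv_at1 pi \in orbit1 P -> pi \in P.
Proof.
move=> reg sPN Npi /imsetP[rho Prho e].
suff -> : pi = rho by [].
apply: (regular_eq (x := inv_at1 pi) reg Npi); first exact: (subsetP sPN).
by rewrite {2}e /inv_at1 !permKV.
Qed.

Lemma orbit1_lam (A : {group G}) : orbit1 [set lam g | g in A] = A.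
Proof.
apply/setP => g; apply/imsetP/idP => [[_ /imsetP[h Ah ->] ->] | Ag].
  by rewrite inv_at1_lam groupV.
by exists (lam g^-1); rewrite ?imset_f ?groupV // inv_at1_lam invgK.
Qed.

Lemma orbit1_ltr (A : {group G}) : orbit1 [set ltr g | g in A] = A.
Proof.
apply/setP => g; apply/imsetP/idP => [[_ /imsetP[h Ah ->] ->] | Ag].
  by rewrite inv_at1_ltr groupV.
by exists (ltr g^-1); rewrite ?imset_f ?groupV // inv_at1_ltr invgK.
Qed.

Lemma lam_group_set (A : {group G}) : group_set [set lam g | g in A].
Proof.
apply/group_setP; split; first by rewrite -lam1 imset_f.
by move=> _ _ /imsetP[g Ag ->] /imsetP[h Ah ->]; rewrite -lamM imset_f ?groupM.
Qed.

Lemma ltr_group_set (A : {group G}) : group_set [set ltr g | g in A].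
Proof.
apply/group_setP; split; first by rewrite -ltr1 imset_f.
by move=> _ _ /imsetP[g Ag ->] /imsetP[h Ah ->]; rewrite -ltrM imset_f ?groupM.
Qed.

Definition lam_sub A := Group (lam_group_set A).
Definition ltr_sub A := Group (ltr_group_set A).

Lemma lam_sub_stable (A : {group G}) :
  (forall g h, g \in A -> g ^ h \in A) -> lambda_image K \subset 'N(lam_sub A).
Proof.
move=> nA; apply: lambda_norms => g _ /imsetP[h Ah ->].
by rewrite lam_conj; apply/imset_f/nA.
Qed.

Lemma ltr_sub_stable (A : {group G}) : lambda_image K \subset 'N(ltr_sub A).
Proof.
by apply: lambda_norms => g _ /imsetP[h Ah ->]; rewrite ltr_conj; apply: imset_f.
Qed.

End RegularGroups.

Section DihedralRegular.

Local Open Scope group_scope.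

Variables (k : fieldType) (K : splittingFieldType k) (p : nat).
Local Notation G := (gal_of {:K}).
Local Notation lam := (@gal_lambda k K).
Local Notation ltr := (@ltr k K).
Variables sigma tau : G.
Hypotheses (p_prime : prime p) (p_ge3 : 2 < p).
Hypothesis card_dih : #|[set: G]| = (2 * p)%N.
Hypothesis gen_dih : [set: G] = <<[set sigma; tau]>>.
Hypotheses (sigma_p : sigma ^+ p = 1) (tau_2 : tau ^+ 2 = 1).
Hypothesis sigma_tau : sigma ^ tau = sigma^-1.
Implicit Types (g h x y s t : G) (pi : {perm G}).

Local Notation S := <[sigma]>.

Let order_sigma := dih_order_sigma p_prime card_dih gen_dih sigma_p tau_2 sigma_tau.
Let tauNS := dih_tauNS p_prime card_dih gen_dih sigma_p tau_2 sigma_tau.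
Let conjS := dih_conjS gen_dih tau_2 sigma_tau.
Let invol := dih_invol p_prime card_dih gen_dih sigma_p tau_2 sigma_tau.
Let invN := dih_invN p_prime card_dih gen_dih sigma_p tau_2 sigma_tau.
Let mulNN := dih_mulNN p_prime card_dih gen_dih sigma_p tau_2 sigma_tau.
Let flip := dih_flip gen_dih tau_2 sigma_tau.
Let order2 := dih_order2 p_prime card_dih gen_dih sigma_p tau_2 sigma_tau.
Let sq1 := dih_sq1 p_prime p_ge3 card_dih gen_dih sigma_p tau_2 sigma_tau.

Lemma conjS_in s g : s \in S -> s ^ g \in S.
Proof.
move=> Ss; have [Sg | nSg] := boolP (g \in S); first by rewrite groupJ.
by rewrite conjS ?groupV.
Qed.

Lemma lam_order s : #[lam s] = #[s].
Proof.
apply/eqP; rewrite eqn_dvd !order_dvdn -lamX expg_order lam1 eqxx /=.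
by rewrite -(inj_eq (@lam_inj _ K)) lamX expg_order lam1.
Qed.

Lemma ltr_order s : #[ltr s] = #[s].
Proof.
apply/eqP; rewrite eqn_dvd !order_dvdn -ltrX expg_order ltr1 eqxx /=.
by rewrite -(inj_eq (@ltr_inj _ K)) ltrX expg_order ltr1.
Qed.

(** Multiplication by sigma on one side and by the reflection t on the other
    commute and have coprime orders: this is a cyclic group of order 2p. *)
Definition cyc_group t : {group {perm G}} := <[lam sigma * ltr t]>%G.

Lemma cyc_split t : t \notin S -> cyc_group t = <[lam sigma]> * <[ltr t]> :> {set _}.
Proof.
move=> nSt; rewrite /= cycleM //; first exact/commute_sym/ltr_lam.
rewrite lam_order ltr_order order_sigma order2 // coprimen2.
exact: dih_odd p_prime p_ge3.
Qed.

Lemma card_cyc t : t \notin S -> #|cyc_group t| = (2 * p)%N.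
Proof.
move=> nSt; rewrite -[LHS]/#[lam sigma * ltr t] orderM.
- by rewrite lam_order ltr_order order_sigma order2 // mulnC.
- exact/commute_sym/ltr_lam.
rewrite lam_order ltr_order order_sigma order2 // coprimen2.
exact: dih_odd p_prime p_ge3.
Qed.

Lemma cycP t pi : t \notin S -> reflect
  (exists2 s, s \in S & pi = lam s \/ pi = lam s * ltr t) (pi \in cyc_group t).
Proof.
move=> nSt; rewrite [_ \in _](_ : _ = (pi \in <[lam sigma]> * <[ltr t]>)); last first.
  by rewrite -cyc_split.
apply: (iffP mulsgP) => [[_ _ /cycleP[i ->] /cycleP[j ->] ->] | [s]].
  exists (sigma ^+ i); rewrite ?mem_cycle // lamX.
  rewrite -(odd_double_half j) expgD -muln2 mulnC expgM.
  rewrite expg2 -ltrM invol // ltr1 expg1n mulg1.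
  by case: (odd j); rewrite ?expg1 ?mulg1; [right | left].
case/cycleP => i -> [] ->; rewrite lamX.
  by exists (lam sigma ^+ i) 1; rewrite ?mem_cycle ?mulg1 ?group1.
by exists (lam sigma ^+ i) (ltr t); rewrite ?mem_cycle ?cycle_id.
Qed.

Lemma cyc_stable t : t \notin S -> lambda_image K \subset 'N(cyc_group t).
Proof.
move=> nSt; apply: lambda_norms => g pi /(cycP _ nSt)[s Ss e].
apply/(cycP _ nSt); exists (s ^ g); rewrite ?conjS_in //.
by case: e => ->; rewrite ?conjMg lam_conj ?ltr_conj; [left | right].
Qed.

Lemma cyc_regular t : t \notin S -> regular (cyc_group t).
Proof.
move=> nSt; apply: regular_transitive => [x y|]; last by rewrite card_cyc ?card_dih.
have [Sxy | nSxy] := boolP (x^-1 * y \in S).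
  exists (lam (x^-1 * y)); last by rewrite lamE mulKVg.
  by apply/(cycP _ nSt); exists (x^-1 * y) => //; left.
have e : (t * x)^-1 * y = x^-1 * t * x * (x^-1 * y).
  by rewrite invMg (invN nSt) !mulgA mulgK.
exists (lam ((t * x)^-1 * y) * ltr t).
  apply/(cycP _ nSt); exists ((t * x)^-1 * y); last by right.
  rewrite e mulNN // -mulgA -conjgE.
  by apply: contra nSt => /(conjS_in x^-1); rewrite conjgK.
by rewrite -ltr_lam permM ltrE lamE mulKVg.
Qed.

Section Classification.

Variable N : {group {perm G}}.
Hypotheses (N_regular : regular N) (N_stable : lambda_image K \subset 'N(N)).

Lemma card_N : #|N| = (2 * p)%N.
Proof. by rewrite card_regular. Qed.

Section Sylow.

Variable f : {perm G}.
Hypotheses (Nf : f \in N) (of_p : #[f] = p).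

Lemma sylow_normal : <[f]> <| N.
Proof.
apply: index2_normal; rewrite ?cycle_subG //.
by rewrite -divgS ?cycle_subG // card_N -orderE of_p mulnK ?prime_gt0.
Qed.

(** As p is odd, <[f]> is the normal Sylow p-subgroup of N, so lambda(G), which
    normalises N, normalises it too. *)
Lemma sylow_char : <[f]> \char N.
Proof.
rewrite -(@normal_Hall_pcore p _ <[f]>%G N) ?pcore_char ?sylow_normal //.
rewrite pHallE cycle_subG Nf /= -orderE of_p card_N p_part lognM ?prime_gt0 //.
rewrite logn_prime // logn_prime // eqxx.
by rewrite (_ : p == 2 = false) ?expn1 //; apply: gtn_eqF.
Qed.

Lemma sylow_conj_lam g : f ^ lam g \in <[f]>.
Proof.
rewrite memJ_norm ?cycle_id //; apply: (subsetP (char_norms sylow_char)).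
by rewrite (subsetP N_stable) ?mem_lambda.
Qed.

Lemma sylow_conj pi : pi \in N -> f ^ pi \in <[f]>.
Proof.
move=> Npi; rewrite memJ_norm ?cycle_id //.
exact: (subsetP (normal_norm sylow_normal)).
Qed.

(** The normaliser of <[f]> contains lambda(sigma), of order p, which therefore
    commutes with f. *)
Lemma sylow_equivariant s x : s \in S -> f (x * s) = f x * s.
Proof.
have fsig : f ^ lam sigma = f.
  apply: (conj_fixed_prime_order p_prime of_p (sylow_conj_lam _)).
  by rewrite -lamX sigma_p lam1.
case/cycleP => i ->; elim: i x => [|i IHi] x; first by rewrite !expg0 !mulg1.
rewrite expgSr !mulgA -IHi -{1}fsig conj_lamE.
by rewrite mulgK.
Qed.

(** f permutes the two cosets of S, and has odd order. *)
Lemma sylow_preserves x : (f x \in S) = (x \in S).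
Proof.
have swap : f 1 \notin S -> forall y, (f y \in S) = (y \notin S).
  move=> nS y; have f_in s : s \in S -> f s = f 1 * s.
    by move=> Ss; rewrite -sylow_equivariant // mul1g.
  have [Sy | nSy] /= := boolP (y \in S).
    by rewrite f_in // groupMr // (negbTE nS).
  apply: contraR nSy => nSfy; have Ss : (f 1)^-1 * f y \in S.
    by rewrite mulNN // groupV.
  suff -> : y = (f 1)^-1 * f y by [].
  by apply: (@perm_inj _ f); rewrite [RHS]f_in // mulKVg.
have f1 : f 1 \in S.
  apply: contraT => nS.
  have par n y : ((f ^+ n) y \in S) = (y \in S) (+) odd n.
    elim: n y => [|n IHn] y; first by rewrite expg0 perm1 addbF.
    by rewrite expgSr permM swap // IHn /= addbN.
  have := par p 1; rewrite -{1}of_p expg_order perm1 group1.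
  by rewrite (dih_odd p_prime p_ge3).
have f_in s : s \in S -> f s \in S.
  by move=> Ss; rewrite -[s]mul1g sylow_equivariant // groupM.
apply/idP/idP => [|/f_in//].
rewrite -{2}[x](permK f).
have : f^-1 = f ^+ p.-1.
  by apply/eqP; rewrite eq_invg_mul -expgS prednK ?prime_gt0 // -of_p expg_order.
move=> ->; move: (f x) (p.-1) => y n Sy; elim: n => [|n IHn].
  by rewrite expg0 perm1.
by rewrite expgSr permM f_in.
Qed.

Lemma sylow_val_gen : <[f 1]> = S.
Proof.
apply/esym/nt_gen_prime; first by rewrite -orderE order_sigma.
rewrite !inE sylow_preserves group1 andbT.
apply/eqP => f1; have : f = 1.
  by apply: (@regular_eq _ _ _ _ _ 1 N_regular); rewrite ?group1 ?f1 ?perm1.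
by move=> f_1; move: of_p p_prime; rewrite f_1 order1 => <-.
Qed.

(** lambda(tau) fixes or inverts f. *)
Lemma sylow_cases : <[f]> = <[lam sigma]> \/ <[f]> = <[ltr sigma]>.
Proof.
have Sf1 : f 1 \in S by rewrite sylow_preserves group1.
have same_sub (T : G -> {perm G}) : (forall g n, T (g ^+ n) = T g ^+ n) ->
    (forall g, #[T g] = #[g]) -> f = T (f 1) -> <[f]> = <[T sigma]>.
  move=> TX oT Df; apply/esym/eqP; rewrite eqEcard -!orderE oT order_sigma of_p.
  rewrite leqnn andbT cycle_subG Df; have : sigma \in <[f 1]>.
    by rewrite sylow_val_gen cycle_id.
  by case/cycleP => i ->; rewrite TX mem_cycle.
have nf := sylow_conj_lam tau.
have [|ftau|ftau] := conj_pm_prime_order p_prime of_p nf.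
- by rewrite -lamM -expg2 tau_2 lam1 conjg1.
- right; apply: same_sub => [g n||]; [exact: ltrX | exact: ltr_order|].
  apply/permP => x; rewrite ltrE.
  have [Sx | nSx] := boolP (x \in S).
    by rewrite -{1}[x]mul1g sylow_equivariant.
  have /(dih_notS gen_dih tau_2 sigma_tau)[s Ss ->] := nSx.
  by rewrite -{1}ftau conj_lamE mulgK -[s]mul1g sylow_equivariant // mul1g mulgA.
left; apply: same_sub => [g n||]; [exact: lamX | exact: lam_order|].
apply/permP => x; rewrite lamE.
have in_S s : s \in S -> f s = s * f 1.
  move=> Ss; rewrite -{1}[s]mul1g sylow_equivariant //.
  exact: dih_commS Sf1 Ss.
have [Sx | nSx] := boolP (x \in S); first exact: in_S.
have nSfx : f x \notin S by rewrite sylow_preserves.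
have Sfxt : f x * tau^-1 \in S by rewrite mulNN ?groupV.
have /permP/(_ (f x)) := ftau; rewrite conj_lamE permK in_S // => e.
by apply: (mulIg (f 1)^-1); rewrite mulgK -(conjS Sf1 tauNS) conjgE !mulgA.
Qed.

End Sylow.

Lemma lam_mem g : lam sigma \in N -> g \in S -> lam g \in N.
Proof. by move=> Nr /cycleP[i ->]; rewrite lamX groupX. Qed.

Lemma ltr_mem g : ltr sigma \in N -> g \in S -> ltr g \in N.
Proof. by move=> Nr /cycleP[i ->]; rewrite ltrX groupX. Qed.

(** By regularity the elements of N that send 1 into S are the powers of an
    element of order p, and no involution is such a power. *)
Lemma exists_involution : exists th, exists t,
  [/\ th \in N, th * th = 1, t \notin S, th 1 = t & th t = 1].
Proof.
have [f Nf of_p] : {f | f \in N & #[f] = p}.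
  by apply: Cauchy; rewrite ?card_N ?dvdn_mull.
have [th Nth oth] : {th | th \in N & #[th] = 2}.
  by apply: Cauchy; rewrite ?card_N ?dvdn_mulr.
have thth : th * th = 1 by rewrite -expg2 -oth expg_order.
exists th, (th 1); split=> //; last by rewrite -permM thth perm1.
rewrite -(sylow_val_gen Nf of_p); apply/negP => /cycleP[i th1].
have fX n : (f ^+ n) 1 = f 1 ^+ n.
  elim: n => [|n IHn]; first by rewrite perm1.
  rewrite expgSr permM IHn expgS -{1}[f 1 ^+ n]mul1g (sylow_equivariant Nf) //.
  by rewrite groupX // (sylow_preserves Nf) ?group1.
have Dth : th = f ^+ i.
  by apply: (regular_eq (x := 1) N_regular); rewrite ?groupX // fX.
have : #[th] %| p by rewrite order_dvdn Dth expgAC -of_p expg_order expg1n.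
by rewrite oth dvdn2 (dih_odd p_prime p_ge3).
Qed.

(** The p-part of N is lambda(S) or rho(S), and an involution th of N commutes
    with it or inverts it, which gives four groups.  The last one, generated by
    rho(S) and lambda(t), is not stable. *)
Lemma classification :
  [\/ N = rho_image K :> {set _}, N = lambda_image K :> {set _}
    | exists c : 'I_p, N = cyc_group (sigma ^+ c.+1 * tau) :> {set _}].
Proof.
have [th [t [Nth thth nSt th1 tht]]] := exists_involution.
have [f Nf of_p] : {f | f \in N & #[f] = p}.
  by apply: Cauchy; rewrite ?card_N ?dvdn_mull.
have [Df | Df] := sylow_cases Nf of_p.
  have Nr : lam sigma \in N.
    by rewrite -cycle_subG -Df cycle_subG.
  have or : #[lam sigma] = p by rewrite lam_order.
  have [|rth|rth] := conj_pm_prime_order p_prime or (sylow_conj Nr or Nth).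
  - by rewrite thth conjg1.
  - have thM y s : s \in S -> th (y * s) = th y * s.
      case/cycleP => i ->; have : (lam (sigma ^+ i)) ^ th = lam (sigma ^+ i).
        by rewrite lamX conjXg rth.
      by move=> e; rewrite -!lamE -!permM -{2}e -conjgC.
    have Dth : th = ltr t.
      apply/permP => x; rewrite ltrE; have [Sx | nSx] := boolP (x \in S).
        by rewrite -[x in LHS]mul1g thM // th1.
      by rewrite -[x in LHS](mulKg t) invN // thM ?mulNN // tht mul1g.
    have [c Dt] := dih_reflectionS p_prime card_dih gen_dih sigma_p tau_2 sigma_tau nSt.
    constructor 3; exists c; rewrite -Dt; apply/esym/regular_sub => //.
      exact: cyc_regular.
    by rewrite cycle_subG groupM // -Dth.
  have thM y s : s \in S -> th (y * s) = th y * s^-1.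
    case/cycleP => i ->; have : (lam (sigma ^+ i)) ^ th = lam (sigma ^+ i)^-1.
      by rewrite lamX conjXg rth lamV lamX expgVn.
    by move=> e; rewrite -!lamE -!permM -e -conjgC.
  have Dth : th = lam t.
    apply/permP => x; rewrite lamE; have [Sx | nSx] := boolP (x \in S).
      by rewrite -[x in LHS]mul1g thM // th1 (flip Sx).
    rewrite -[x in LHS](mulKg t) invN // thM ?mulNN // tht mul1g invMg.
    by rewrite !invN.
  constructor 2; apply/esym/regular_sub => //; first exact: lambda_regular.
  apply/subsetP => _ /lambdaP[g ->]; have [Sg | nSg] := boolP (g \in S).
    exact: lam_mem.
  rewrite -[g](mulKg t) (invN nSt) lamM groupM -?Dth //.
  by rewrite lam_mem ?mulNN.
have Nr : ltr sigma \in N by rewrite -cycle_subG -Df cycle_subG.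
have or : #[ltr sigma] = p by rewrite ltr_order.
have [|rth|rth] := conj_pm_prime_order p_prime or (sylow_conj Nr or Nth).
- by rewrite thth conjg1.
- have thM y s : s \in S -> th (s * y) = s * th y.
    case/cycleP => i ->; have : (ltr (sigma ^+ i)) ^ th = ltr (sigma ^+ i).
      by rewrite ltrX conjXg rth.
    by move=> e; rewrite -!ltrE -!permM -{2}e -conjgC.
  have Dth : th = lam t.
    apply/permP => x; rewrite lamE; have [Sx | nSx] := boolP (x \in S).
      by rewrite -[x in LHS]mulg1 thM // th1.
    by rewrite -[x in LHS](mulgK t) (invN nSt) thM ?mulNN // tht mulg1.
  have Ss : sigma \in S by apply: cycle_id.
  have Sss : sigma * sigma \in S by rewrite groupM.
  have : lam (sigma * sigma) = ltr (sigma * sigma).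
    apply: (regular_eq (x := 1) N_regular); last by rewrite lamE ltrE mulg1 mul1g.
      rewrite (_ : sigma * sigma = t * t ^ sigma).
        by rewrite lamM groupM -?lam_conj ?stable_conj // -Dth.
      by rewrite conjgE 2!mulgA -(flip Ss nSt) -[_ * t * t]mulgA (invol nSt) mulg1.
    by rewrite ltr_mem.
  move/permP/(_ t); rewrite lamE ltrE (flip Sss nSt) => /mulgI e.
  have s4 : sigma * sigma = 1 by apply: sq1; rewrite // {2}e mulgV.
  have s1 : sigma = 1 by apply: sq1.
  by move: order_sigma p_prime; rewrite s1 order1 => <-.
have thM y s : s \in S -> th (s * y) = s^-1 * th y.
  case/cycleP => i ->; have : (ltr (sigma ^+ i)) ^ th = ltr (sigma ^+ i)^-1.
    rewrite ltrX conjXg rth -expgVn ltrX; congr (_ ^+ _).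
    by apply/esym/eqP; rewrite eq_sym eq_invg_mul -ltrM mulVg ltr1.
  by move=> e; rewrite -!ltrE -!permM -e -conjgC.
have Dth : th = ltr t.
  apply/permP => x; rewrite ltrE; have [Sx | nSx] := boolP (x \in S).
    by rewrite -[x in LHS]mulg1 thM // th1 flip ?groupV // invgK.
  rewrite -[x in LHS](mulgK t) (invN nSt) thM ?mulNN // tht mulg1 invMg.
  by rewrite !invN.
constructor 1; apply/esym/regular_sub => //; first exact: rho_regular.
apply/subsetP => _ /rhoP[g ->]; have [Sg | nSg] := boolP (g \in S).
  exact: ltr_mem.
rewrite -[g](mulgK t) (invN nSt) ltrM groupM -?Dth //.
by rewrite ltr_mem ?mulNN.
Qed.

End Classification.

(** The groups of automorphisms whose fixed fields form the image of the Galois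
    correspondence of K[N]^G. *)
Definition reachable (N : {set {perm G}}) (Q : {set G}) :=
  exists P : {group {perm G}},
    [/\ P \subset N, lambda_image K \subset 'N(P) & orbit1 P = Q].

Lemma reachable1 (N : {group {perm G}}) : reachable N 1.
Proof.
exists 1%G; split; rewrite ?sub1G ?norm1 ?subsetT //.
by rewrite /orbit1 imset_set1 /inv_at1 invg1 perm1.
Qed.

Lemma reachableT (N : {group {perm G}}) :
  regular N -> lambda_image K \subset 'N(N) -> reachable N [set: G].
Proof. by move=> reg nN; exists N; split=> //; apply: orbit1_regular. Qed.

Lemma reachable_rho (Q : {group G}) : reachable (rho_image K) Q.
Proof.
exists (ltr_sub Q); split; first by apply/subsetP => _ /imsetP[g _ ->]; apply: mem_rho.
  exact: ltr_sub_stable.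
exact: orbit1_ltr.
Qed.

Lemma reachable_subgroup N Q : reachable N Q ->
  [\/ Q = 1, Q = S, Q = [set: G] | exists2 x, x \notin S & Q = <[x]>].
Proof.
case=> P [_ nP <-].
exact: (dih_subgroups p_prime card_dih gen_dih sigma_p tau_2 sigma_tau
  (Group (orbit1_group_set nP))).
Qed.

Lemma reachable_lambda (Q : {set G}) :
  reachable (lambda_image K) Q <-> [\/ Q = 1, Q = S | Q = [set: G]].
Proof.
split=> [reach | [] ->]; last 3 first.
- exact: (reachable1 (lambda_group K)).
- exists (lam_sub <[sigma]>); split; last exact: orbit1_lam.
    by apply/subsetP => _ /imsetP[g _ ->]; apply: mem_lambda.
  by apply: lam_sub_stable => g h; apply: conjS_in.
- apply: (@reachableT (lambda_group K)); first exact: lambda_regular.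
  exact: lambda_stable.
case: (reachable_subgroup reach) => [||| [x nSx Qx]]; [by constructor..|].
(* The conjugate of x by sigma would be in the group generated by x. *)
case: reach => P [sPN nP PQ]; exfalso.
have Px : lam x \in P.
  apply: (orbit1_mem (@lambda_regular _ K) sPN); first exact: mem_lambda.
  by rewrite inv_at1_lam PQ Qx groupV cycle_id.
have Qxs : (x ^ sigma)^-1 \in <[x]>.
  by rewrite -Qx -PQ -inv_at1_lam; apply: imset_f; rewrite -lam_conj stable_conj.
have nSxs : x ^ sigma \notin S.
  by apply: contra nSx => /(conjS_in sigma^-1); rewrite conjgK.
have := dih_cycle_refl p_prime card_dih gen_dih sigma_p tau_2 sigma_tau nSx Qxs.
rewrite groupV => /(_ nSxs); rewrite invN // conjgE => e.
have Ss := cycle_id sigma.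
have : sigma * sigma = 1.
  have /mulgI s_inv : x * sigma = x * sigma^-1.
    by rewrite -(flip Ss nSx) -{2}e mulKVg.
  by rewrite {2}s_inv mulgV.
move=> /(sq1 Ss) s1; move: order_sigma p_prime; rewrite s1 order1.
by move=> <-.
Qed.

Lemma reachable_cyc t (Q : {set G}) : t \notin S ->
  reachable (cyc_group t) Q <-> [\/ Q = 1, Q = S, Q = <[t]> | Q = [set: G]].
Proof.
move=> nSt; split=> [reach | [] ->]; last 4 first.
- exact: reachable1.
- exists (lam_sub <[sigma]>); split; last exact: orbit1_lam.
    apply/subsetP => _ /imsetP[g Sg ->]; apply/(cycP _ nSt).
    by exists g => //; left.
  by apply: lam_sub_stable => g h; apply: conjS_in.
- exists (ltr_sub <[t]>); split; last exact: orbit1_ltr; last exact: ltr_sub_stable.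
  apply/subsetP => _ /imsetP[_ /cycleP[i ->] ->]; rewrite ltrX groupX //.
  apply/(cycP _ nSt); exists 1; rewrite ?group1 //; right.
  by rewrite lam1 mul1g.
- by apply: reachableT; [apply: cyc_regular | apply: cyc_stable].
case: (reachable_subgroup reach) => [Q1|QS|QT|[x nSx Qx]]; first by constructor 1.
- by constructor 2.
- by constructor 4.
(* The square lambda(s * s) of the element lambda(s) rho(t) of P that moves x to
   1 must be trivial. *)
constructor 3; case: reach => P [sPN nP PQ].
have /imsetP[pi Ppi Dx] : x \in orbit1 P by rewrite PQ Qx cycle_id.
have /(cycP _ nSt)[s Ss [Dpi|Dpi]] := subsetP sPN pi Ppi.
  by move: nSx; rewrite Dx Dpi inv_at1_lam groupV Ss.
have pipi : pi * pi = lam (s * s).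
  rewrite Dpi; apply/permP => y.
  by rewrite !permM !lamE !ltrE !mulgA (invol nSt) mul1g.
have : (s * s)^-1 \in <[x]>.
  by rewrite -Qx -PQ -inv_at1_lam -pipi; apply: imset_f; rewrite groupM.
rewrite groupV => /cycleP[i]; rewrite -(odd_double_half i) expgD -muln2 mulnC.
rewrite expgM expg2 (invol nSx) expg1n mulg1; case: (odd i) => [ssx | ss1].
  by move: nSx; rewrite -[x]expg1 -ssx groupM.
rewrite Qx Dx Dpi (sq1 Ss ss1) lam1 mul1g inv_at1_ltr.
by rewrite invN.
Qed.

End DihedralRegular.

(** * Images of the Galois correspondences *)

Section FixedFields.

Local Open Scope group_scope.

Variables (k : fieldType) (K : splittingFieldType k).
Hypothesis K_galois : galois 1%VS {:K}.
Local Notation G := (gal_of {:K}).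

Lemma fixedField_inj (A B : {group G}) :
  fixedField A = fixedField B -> A = B :> {set G}.
Proof. by move=> AB; rewrite -[LHS]gal_fixedField AB gal_fixedField. Qed.

Lemma fixedField_full : fixedField [set: G] = 1%VS.
Proof. by rewrite -gal_full; apply/galois_fixedField. Qed.

Lemma fixedField_one : fixedField (1 : {set G}) = fullv.
Proof.
apply/vspaceP => x; rewrite memvf; apply/fixedFieldP; first exact: memvf.
by move=> g /set1P->; rewrite gal_id.
Qed.

Lemma image_reachable (H : hopfGalois K) (N : {set {perm G}}) :
  lambda_image K \subset 'N(N) -> given_by H N ->
  forall E : {vspace K}, galois_image H E <->
    exists2 Q : {set G}, reachable N Q & E = fixedField Q.
Proof.
move=> nN HN E; split=> [/(galois_imageP K_galois nN HN)[P [sPN nP ->]] | ].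
  by exists (orbit1 P) => //; exists P.
case=> _ [P [sPN nP <-]] ->; apply/(galois_imageP K_galois nN HN).
by exists P.
Qed.

Lemma reachable_group N Q : reachable N Q -> exists A : {group G}, Q = A :> {set G}.
Proof. by case=> P [_ nP <-]; exists (Group (orbit1_group_set nP)). Qed.

Lemma image_sub_reachable (H1 H2 : hopfGalois K) (N1 N2 : {set {perm G}}) :
  lambda_image K \subset 'N(N1) -> given_by H1 N1 ->
  lambda_image K \subset 'N(N2) -> given_by H2 N2 ->
  (forall E : {vspace K}, galois_image H1 E -> galois_image H2 E) ->
  forall Q : {group G}, reachable N1 Q -> reachable N2 Q.
Proof.
move=> nN1 HN1 nN2 HN2 sub Q reachQ.
have : galois_image H1 (fixedField Q).
  by apply/(image_reachable nN1 HN1); exists (Q : {set G}).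
move/sub/(image_reachable nN2 HN2) => [Q' reachQ' eqQ].
have [A QA] := reachable_group reachQ'; rewrite QA in eqQ reachQ'.
by rewrite (fixedField_inj eqQ).
Qed.

Lemma lambda_isog : lambda_image K \isog [set: G].
Proof.
pose f := @Morphism _ _ [set: G] _ (in2W (@lamM k K)).
have Df : f @* [set: G] = lambda_image K.
  rewrite morphimEdom; apply/setP => pi.
  by apply/imsetP/lambdaP => [[g _ ->] | [g ->]]; exists g; rewrite ?inE.
rewrite -Df -[_ \isog _]/([group of f @* [set: G]] \isog [group of [set: G]]).
rewrite isog_sym sub_isog //; apply/injmP => g h _ _; exact: lam_inj.
Qed.

End FixedFields.

Lemma Zp_group_cyclic n : 1 < n -> cyclic (Zp_group n).
Proof.
move=> n_gt1; rewrite /= /Zp n_gt1; apply/cyclicP.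
by exists Zp1; rewrite Zp_cycle.
Qed.

Section DihedralImages.

Local Open Scope group_scope.

Variables (k : fieldType) (K : splittingFieldType k) (p : nat).
Local Notation G := (gal_of {:K}).
Variables sigma tau : G.
Hypotheses (p_prime : prime p) (p_ge3 : 2 < p).
Hypothesis K_galois : galois 1%VS {:K}.
Hypothesis card_dih : #|[set: G]| = (2 * p)%N.
Hypothesis gen_dih : [set: G] = <<[set sigma; tau]>>.
Hypotheses (sigma_p : sigma ^+ p = 1) (tau_2 : tau ^+ 2 = 1).
Hypothesis sigma_tau : sigma ^ tau = sigma^-1.

Local Notation S := <[sigma]>.
Local Notation refl c := (sigma ^+ c * tau).
Local Notation cyc t := (cyc_group sigma t).
Local Notation C2p := (Zp_group (2 * p)).

Let tauNS := dih_tauNS p_prime card_dih gen_dih sigma_p tau_2 sigma_tau.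
Let reflNS c : refl c \notin S :=
  dih_reflN p_prime card_dih gen_dih sigma_p tau_2 sigma_tau c.
Let cyc_nS t (nSt : t \notin S) :=
  cyc_stable p_prime p_ge3 card_dih gen_dih sigma_p tau_2 sigma_tau nSt.
Let cyc_reg t (nSt : t \notin S) :=
  cyc_regular p_prime p_ge3 card_dih gen_dih sigma_p tau_2 sigma_tau nSt.
Let reach_lambda :=
  reachable_lambda p_prime p_ge3 card_dih gen_dih sigma_p tau_2 sigma_tau.
Let reach_cyc :=
  reachable_cyc p_prime p_ge3 card_dih gen_dih sigma_p tau_2 sigma_tau.

Lemma refl_inj c d : (refl c == refl d) = (c == d %[mod p]).
Proof.
rewrite (inj_eq (mulIg tau)) eq_expg_mod_order.
by rewrite (dih_order_sigma p_prime card_dih gen_dih sigma_p tau_2 sigma_tau).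
Qed.

Lemma cycle_refl_inj x y : x \notin S -> y \notin S -> <[x]> = <[y]> -> x = y.
Proof.
move=> nSx nSy xy.
apply: (dih_cycle_refl p_prime card_dih gen_dih sigma_p tau_2 sigma_tau nSy) => //.
by rewrite -xy cycle_id.
Qed.

Lemma reachable_lambda_refl x : x \notin S -> ~ reachable (lambda_image K) <[x]>.
Proof.
move=> nSx /reach_lambda[] e; apply: (negP nSx).
- by have := cycle_id x; rewrite e => /set1P->; rewrite group1.
- by rewrite -e cycle_id.
have := card_dih; rewrite -e -orderE.
rewrite (dih_order2 p_prime card_dih gen_dih sigma_p tau_2 sigma_tau nSx).
move=> p1; have : 2 * 1 < 2 * p by rewrite ltn_pmul2l // prime_gt1.
by rewrite -p1.
Qed.

Lemma reachable_cyc_refl t x :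
  t \notin S -> x \notin S -> reachable (cyc t) <[x]> -> x = t.
Proof.
move=> nSt nSx /(reach_cyc _ nSt)[] e; last first.
- apply/eqP/negPn/negP => _; apply: (@reachable_lambda_refl x nSx).
  by apply/reach_lambda; constructor 3.
- exact: cycle_refl_inj.
- by have := nSx; rewrite -e cycle_id.
by have := cycle_id x; rewrite e => /set1P x1; move: nSx; rewrite x1 group1.
Qed.

Lemma cyc_of_type t (H : hopfGalois K) :
  t \notin S -> given_by H (cyc t) -> of_type H C2p.
Proof.
move=> nSt HN; exists (cyc t); split=> //; first exact: cyc_reg.
  exact: cyc_nS.
have lt1 : 1 < 2 * p by rewrite (leq_trans (prime_gt1 p_prime)) // leq_pmull.
rewrite isog_cyclic_card ?cycle_cyclic // Zp_group_cyclic //=.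
rewrite card_Zp ?(ltnW lt1) //.
by rewrite (card_cyc p_prime p_ge3 card_dih gen_dih sigma_p tau_2 sigma_tau).
Qed.

Lemma not_comm : sigma * tau <> tau * sigma.
Proof.
move=> st; have : sigma ^ tau = sigma by apply/conjg_fixP/commgP.
rewrite sigma_tau => s_inv.
have s1 : sigma = 1.
  apply: (dih_sq1 p_prime p_ge3 card_dih gen_dih sigma_p tau_2 sigma_tau).
    exact: cycle_id.
  by rewrite -{2}s_inv mulgV.
have := dih_order_sigma p_prime card_dih gen_dih sigma_p tau_2 sigma_tau.
by rewrite s1 order1 => p1; move: p_prime; rewrite -p1.
Qed.

Lemma of_type_cyc (H : hopfGalois K) :
  of_type H C2p -> exists c : 'I_p, given_by H (cyc (refl c.+1)).
Proof.
case=> N [reg nN HN iso].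
have lt1 : 1 < 2 * p by rewrite (leq_trans (prime_gt1 p_prime)) // leq_pmull.
have abN : abelian N.
  by rewrite (isog_abelian iso) cyclic_abelian ?Zp_group_cyclic.
have comm := centsP abN.
have [DN|DN|[c DN]] := classification p_prime p_ge3 card_dih gen_dih sigma_p
  tau_2 sigma_tau reg nN; last by exists c; rewrite DN in HN.
  case: not_comm; apply: (@ltr_inj _ K); rewrite !ltrM.
  by apply: comm; rewrite DN mem_rho.
case: not_comm; apply: (@lam_inj _ K); rewrite !lamM.
by apply: comm; rewrite DN mem_lambda.
Qed.

Definition standard (N : {set {perm G}}) :=
  [\/ N = rho_image K, N = lambda_image K
    | exists c : 'I_p, N = cyc (refl c.+1)].

Lemma standard_stable N : standard N -> lambda_image K \subset 'N(N).
Proof.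
case=> [->|->|[c ->]]; [exact: rho_stable | exact: lambda_stable|].
exact: cyc_nS.
Qed.

Lemma given_by_standard (H : hopfGalois K) : exists2 N, standard N & given_by H N.
Proof.
have [N [reg nN HN]] := hopf_galois_given_by H K_galois.
exists N => //.
exact: (classification p_prime p_ge3 card_dih gen_dih sigma_p tau_2 sigma_tau reg nN).
Qed.

(** The reflections x with <[x]> reachable are all of them for rho(G), none for
    lambda(G), and t alone for the cyclic group of t. *)
Lemma standard_eq N1 N2 : standard N1 -> standard N2 ->
  (forall Q : {group G}, reachable N1 Q <-> reachable N2 Q) -> N1 = N2.
Proof.
have two t : exists2 x, x \notin S & x != t.
  have [<- | nt] := eqVneq tau t; last by exists tau.
  exists (refl 1%N) => //; rewrite -{2}[tau]mul1g -(expg0 sigma) refl_inj.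
  by rewrite !modn_small // ?(prime_gt1 p_prime) ?(prime_gt0 p_prime).
have rho_lam : ~ forall Q : {group G},
    reachable (rho_image K) Q -> reachable (lambda_image K) Q.
  by move/(_ <[tau]>%G (reachable_rho _)); apply: reachable_lambda_refl.
have rho_cyc t : t \notin S -> ~ forall Q : {group G},
    reachable (rho_image K) Q -> reachable (cyc t) Q.
  move=> nSt sub; have [x nSx /eqP[]] := two t.
  by apply: reachable_cyc_refl => //; apply/(sub <[x]>%G)/reachable_rho.
have cyc_lam t : t \notin S -> ~ forall Q : {group G},
    reachable (cyc t) Q -> reachable (lambda_image K) Q.
  move=> nSt /(_ <[t]>%G) sub; apply: (reachable_lambda_refl nSt); apply: sub.
  by apply/reach_cyc => //; constructor 3.
case=> [->|->|[c ->]] [->|->|[d ->]] // eqR.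
- by case: rho_lam => Q /eqR.
- by case: (rho_cyc _ (reflNS d.+1)) => Q /eqR.
- by case: rho_lam => Q /eqR.
- by case: (cyc_lam _ (reflNS d.+1)) => Q /eqR.
- by case: (rho_cyc _ (reflNS c.+1)) => Q /eqR.
- by case: (cyc_lam _ (reflNS c.+1)) => Q /eqR.
congr (_ (cyc _)); apply: reachable_cyc_refl => //.
by apply/(eqR <[refl c.+1]>%G)/reach_cyc => //; constructor 3.
Qed.

End DihedralImages.

Theorem mainTheorem5 (p : nat) (k : fieldType) (K : splittingFieldType k)
    (sigma tau : gal_of {:K})
    (p_prime : prime p) (p_ge3 : 3 <= p)
    (K_galois : galois 1%VS {:K})
    (card_G : #|'Gal({:K} / 1)%g| = (2 * p)%N)
    (gen_G : 'Gal({:K} / 1)%g = <<[set sigma; tau]>>%g)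
    (sigma_p : (sigma ^+ p = 1)%g) (tau_2 : (tau ^+ 2 = 1)%g)
    (tau_sigma : gal_comp tau sigma = gal_comp (sigma ^+ p.-1)%g tau) :
  let Ksigma : {vspace K} := fixedField <[sigma]>%g in
  let Ktau (c : nat) : {vspace K} :=
    fixedField <[gal_comp tau (sigma ^+ c)%g]>%g in
  [/\ (* every structure is one of the p + 2 structures below *)
      forall H : hopfGalois K,
        [\/ given_by H (rho_image K), given_by H (lambda_image K)
          | of_type H (Zp_group (2 * p))],
      (* (1) *)
      (exists H : hopfGalois K, given_by H (rho_image K)) /\
      (forall H : hopfGalois K, given_by H (rho_image K) ->
         (forall E : {vspace K}, galois_image H E <->
            exists F : {subfield K}, E = F) /\
         (forall E : {vspace K}, galois_image H E <->
            [\/ E = 1%VS, E = fullv, E = Ksigma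
              | exists2 c : nat, c < p & E = Ktau c])),
      (* (2) *)
      (exists H : hopfGalois K, given_by H (lambda_image K)) /\
      (forall H : hopfGalois K, given_by H (lambda_image K) ->
         [/\ ~ given_by H (rho_image K),
             of_type H ('Gal({:K} / 1))%G
           & forall E : {vspace K}, galois_image H E <->
               [\/ E = 1%VS, E = Ksigma | E = fullv]]),
      (* (3): the index c : 'I_p stands for c.+1 in {1, ..., p} *)
      (exists Hc : 'I_p -> hopfGalois K,
         [/\ forall c, of_type (Hc c) (Zp_group (2 * p)),
             forall c d, hg_iso (Hc c) (Hc d) -> c = d,
             forall H, of_type H (Zp_group (2 * p)) ->
               exists c, hg_iso H (Hc c)
           & forall (c : 'I_p) (E : {vspace K}), galois_image (Hc c) E <->
               [\/ E = 1%VS, E = Ksigma, E = Ktau c.+1 | E = fullv]])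
    & (* different structures have different images *)
      forall H1 H2 : hopfGalois K, ~ hg_iso H1 H2 ->
        ~ (forall E : {vspace K}, galois_image H1 E <-> galois_image H2 E)].
Proof.
set S := <[sigma]>%g.
have DG := gal_full K; rewrite DG in card_G gen_G.
have sigma_tau : (sigma ^ tau = sigma^-1)%g.
  rewrite conjgE -[(sigma * tau)%g]/(gal_comp tau sigma) tau_sigma mulKg.
  apply/eqP; rewrite eq_sym eq_invg_mul -expgS prednK ?prime_gt0 //.
  by rewrite sigma_p.
move=> Ksigma Ktau.
have KtauE c : Ktau c = fixedField <[sigma ^+ c * tau]>%g by [].
have reflNS c := dih_reflN p_prime card_G gen_G sigma_p tau_2 sigma_tau c.
pose cyc c := cyc_group sigma (sigma ^+ c * tau)%g.
have cyc_st c : (lambda_image K \subset 'N(cyc c))%g.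
  exact: (cyc_stable p_prime p_ge3 card_G gen_G sigma_p tau_2 sigma_tau (reflNS c)).
have cyc_reg c : regular (cyc c).
  exact: (cyc_regular p_prime p_ge3 card_G gen_G sigma_p tau_2 sigma_tau (reflNS c)).
have cyc_type c H : given_by H (cyc c) -> of_type H (Zp_group (2 * p)).
  exact: (cyc_of_type p_prime p_ge3 card_G gen_G sigma_p tau_2 sigma_tau).
have type_cyc := of_type_cyc p_prime p_ge3 card_G gen_G sigma_p tau_2 sigma_tau.
have std_st N : standard p sigma tau N -> (lambda_image K \subset 'N(N))%g.
  exact: standard_stable.
have std_ex H : exists2 N, standard p sigma tau N & given_by H N.
  exact: given_by_standard.
have std_eq N1 N2 := @standard_eq _ _ _ _ _ p_prime p_ge3 card_G gen_G sigma_p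
  tau_2 sigma_tau N1 N2.
have imageE H N : standard p sigma tau N -> given_by H N ->
    forall E : {vspace K}, galois_image H E <->
      exists2 Q : {set gal_of {:K}}, reachable N Q & E = fixedField Q.
  by move=> /std_st nN; apply: image_reachable.
have rho_std : standard p sigma tau (rho_image K) by constructor 1.
have lam_std : standard p sigma tau (lambda_image K) by constructor 2.
have cyc_std (c : 'I_p) : standard p sigma tau (cyc c.+1).
  by constructor 3; exists c.
have same_image H1 H2 N1 N2 : standard p sigma tau N1 -> standard p sigma tau N2 ->
    given_by H1 N1 -> given_by H2 N2 ->
    (forall E : {vspace K}, galois_image H1 E <-> galois_image H2 E) -> N1 = N2.
  move=> std1 std2 HN1 HN2 eqI; apply: std_eq => // Q.
  by split; apply: (image_sub_reachable K_galois _ _ _ _ _); eauto => E /eqI.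
split.
- move=> H; have [N [->|->|[c ->]] HN] := std_ex H; [by constructor 1 | by constructor 2 |].
  by constructor 3; apply: cyc_type HN.
- split.
    apply: (given_by_exists K_galois (N := rho_group K)).
      exact: rho_stable.
    exact: rho_regular.
  move=> H HN; have imE := imageE H _ rho_std HN.
  split=> E; have [imI reachI] := imE E; split.
  + case/imI => Q _ ->.
    by exists [aspace of fixedField Q].
  + case=> F DE; apply: reachI; exists ('Gal({:K} / F))%g; first exact: reachable_rho.
    rewrite DE; apply/esym/galois_fixedField; apply: galoisS K_galois.
    by rewrite sub1v subvf.
  + case/imI => Q reach ->.
    have [->|->|->|[x nSx ->]] := reachable_subgroup p_prime card_G gen_G sigma_p
      tau_2 sigma_tau reach.
    * by constructor 2; apply: fixedField_one.
    * by constructor 3.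
    * by constructor 1; apply: fixedField_full.
    have [c ->] := dih_reflection p_prime card_G gen_G sigma_p tau_2 sigma_tau nSx.
    by constructor 4; exists (c : nat); rewrite ?ltn_ord.
  + move=> DE; apply: reachI; case: DE => [->|->|->|[c _ ->]].
    * by exists [set: gal_of {:K}]; [apply: reachable_rho | rewrite fixedField_full].
    * by exists 1%g; [apply: reachable_rho | rewrite fixedField_one].
    * by exists S => //; apply: reachable_rho.
    by exists <[sigma ^+ c * tau]>%g => //; apply: reachable_rho.
- have reach_lam := reachable_lambda p_prime p_ge3 card_G gen_G sigma_p tau_2
    sigma_tau.
  split.
    apply: (given_by_exists K_galois (N := lambda_group K)).
      exact: lambda_stable.
    exact: lambda_regular.
  move=> H HN; split.
  + move=> HN'; have DN := same_image H H _ _ rho_std lam_std HN' HN (fun=> iff_refl _).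
    have := reachable_rho <[tau]>%G; rewrite DN.
    apply: (reachable_lambda_refl p_prime p_ge3 card_G gen_G sigma_p tau_2 sigma_tau).
    exact: (dih_tauNS p_prime card_G gen_G sigma_p tau_2 sigma_tau).
  + exists (lambda_group K); split=> //; first exact: lambda_regular.
      exact: lambda_stable.
    by rewrite /= DG; apply: lambda_isog.
  move=> E; have [imI reachI] := imageE H _ lam_std HN E; split.
  + case/imI => Q /reach_lam[->|->|->] ->; [constructor 3 | constructor 2 | constructor 1] => //.
      exact: fixedField_one.
    exact: fixedField_full.
  move=> DE; apply: reachI.
  case: DE => ->; [exists [set: gal_of {:K}] | exists S | exists 1%g].
  + by apply/reach_lam; constructor 3.
  + by rewrite fixedField_full.
  + by apply/reach_lam; constructor 2.
  + by [].
  + by apply/reach_lam; constructor 1.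
  by rewrite fixedField_one.
- have /fin_all_exists[Hc HcN] (c : 'I_p) : exists H : hopfGalois K, given_by H (cyc c.+1).
    exact: given_by_exists.
  have reach_cyc c := reachable_cyc p_prime p_ge3 card_G gen_G sigma_p tau_2
    sigma_tau _ (reflNS c).
  exists Hc; split.
  + by move=> c; apply: cyc_type (HcN c).
  + move=> c d iso; have HdN := given_by_iso iso (HcN d).
    have DN := same_image _ _ _ _ (cyc_std c) (cyc_std d) (HcN c) HdN (fun=> iff_refl _).
    have : reachable (cyc d.+1) <[sigma ^+ c.+1 * tau]>%g.
      by rewrite -DN; apply/reach_cyc; constructor 3.
    move/(reachable_cyc_refl p_prime p_ge3 card_G gen_G sigma_p tau_2 sigma_tau
      (reflNS d.+1) (reflNS c.+1)) => /eqP.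
    rewrite (refl_inj p_prime card_G gen_G sigma_p tau_2 sigma_tau).
    rewrite -addn1 -[d.+1]addn1 eqn_modDr !modn_small // => /eqP cd.
    exact: val_inj.
  + move=> H /type_cyc[c HN]; exists c.
    exact: given_by_unique HN (HcN c).
  move=> c E; have [imI reachI] := imageE (Hc c) _ (cyc_std c) (HcN c) E; split.
  + case/imI => Q /reach_cyc[->|->|->|->] ->.
    * by constructor 4; apply: fixedField_one.
    * by constructor 2.
    * by constructor 3.
    by constructor 1; apply: fixedField_full.
  move=> DE; apply: reachI; case: DE => ->.
  + exists [set: gal_of {:K}]; last by rewrite fixedField_full.
    by apply/reach_cyc; constructor 4.
  + by exists S => //; apply/reach_cyc; constructor 2.
  + by exists <[sigma ^+ c.+1 * tau]>%g => //; apply/reach_cyc; constructor 3.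
  exists 1%g; last by rewrite fixedField_one.
  by apply/reach_cyc; constructor 1.
move=> H1 H2 not_iso eqI.
have [N1 std1 HN1] := std_ex H1; have [N2 std2 HN2] := std_ex H2.
have DN := same_image _ _ _ _ std1 std2 HN1 HN2 eqI.
by apply: not_iso; apply: (given_by_unique K_galois) HN1 _; rewrite DN.
Qed.
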